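(* Let $\varphi,\psi$ be functions of $x$ and $\alpha$ a constant such that $$\frac{\psi''}{\psi}=\frac{\varphi''}{\varphi}=-2\psi\varphi+2x,\qquad \varphi'\psi-\varphi\psi'=2\alpha ,$$ and let $F_\infty=\sum_{n\ge 0}a_n(x)t^{-n}$, $G_\infty=\sum_{n\ge 0}b_n(x)t^{-n}$ be the formal series whose coefficients are defined by $a_0=\varphi$, $b_0=\psi$ and, for $n\ge 1$, $a_n=a_{n-1}'+\psi\sum_{i+j=n-2,\ i,j\ge 0}a_ia_j$, $b_n=b_{n-1}'+\varphi\sum_{i+j=n-2,\ i,j\ge 0}b_ib_j$. Put $z=-\psi\varphi$, $u_{-1}=-\psi'/\psi$, $u_0=\varphi'/\varphi$. (i) There exists a formal function $Y_1(x,t)$ satisfying simultaneously $$F_\infty=\frac{t}{\psi}\left(\frac{1}{Y_1}\frac{\partial Y_1}{\partial x}+\frac t2\right)\quad\text{and}\quad F_\infty=\frac{2t}{\psi'-t\psi}\left[\frac{1}{Y_1}\frac{\partial Y_1}{\partial t}+\frac14\left(\frac{\psi''}{\psi}-t^2\right)\right].$$ For such $Y_1$, putting $Y_2=\frac1\psi\left(\frac{\partial Y_1}{\partial x}+\frac{tY_1}{2}\right)$, the vector $Y=\begin{pmatrix} Y_1 \\ Y_2 \end{pmatrix}$ satisfies $$\frac{\partial Y}{\partial t}=\begin{pmatrix}\frac{t^2}{4}-\frac z2-\frac x2 & -\frac{\psi}{2}(t+u_{-1})\\ \frac1\psi\left\{(u_{-1}-t)\frac z2+\alpha\right\} & -\frac{t^2}{4}+\frac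 z2+\frac x2\end{pmatrix}Y,\qquad \frac{\partial Y}{\partial x}=\begin{pmatrix}-\frac t2&\psi\\ \frac z\psi&\frac t2\end{pmatrix}Y .$$ (ii) There exists a formal function $Z_1(x,t)$ satisfying simultaneously $$G_\infty=\frac{t}{\varphi}\left(\frac{1}{Z_1}\frac{\partial Z_1}{\partial x}+\frac t2\right)\quad\text{and}\quad G_\infty=\frac{2t}{\varphi'-t\varphi}\left[\frac{1}{Z_1}\frac{\partial Z_1}{\partial t}+\frac14\left(\frac{\varphi''}{\varphi}-t^2\right)\right].$$ For such $Z_1$, putting $Z_2=\frac1\varphi\left(\frac{\partial Z_1}{\partial x}+\frac{tZ_1}{2}\right)$, the vector $Z=\begin{pmatrix} Z_1 \\ Z_2 \end{pmatrix}$ satisfies $$\frac{\partial Z}{\partial t}=\begin{pmatrix}\frac{t^2}{4}-\frac z2-\frac x2 & -\frac{\varphi}{2}(t-u_{0})\\ -\frac1\varphi\left\{(u_{0}+t)\frac z2+\alpha\right\} & -\frac{t^2}{4}+\frac z2+\frac x2\end{pmatrix}Z,\qquad \frac{\partial Z}{\partial x}=\begin{pmatrix}-\frac t2&\varphi\\ \frac z\varphi&\frac t2\end{pmatrix}Z .$$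
   Context: A prime denotes $d/dx$. The functions $\varphi,\psi$ are holomorphic and nowhere zero on a domain $D\subset\mathbb{C}$ (variable $x$), and $\alpha\in\mathbb{C}$. Let $\mathcal{O}$ be the ring of holomorphic functions on $D$. Everything is formal in $t$ near $t=\infty$: series are elements of the ring $\mathcal{O}((t^{-1}))$ of formal Laurent series in $t^{-1}$ (finitely many positive powers of $t$), with $\partial/\partial x$ and $\partial/\partial t$ acting termwise; $\psi'-t\psi$ and $\varphi'-t\varphi$ are invertible there. A formal function $Y_1$ (or $Z_1$) is a formal expression $\exp(P)\,t^{c}\,S$ where $P$ is a polynomial in $t$ with coefficients in $\mathcal{O}$, $c\in\mathbb{C}$ is a constant, and $S\in\mathcal{O}((t^{-1}))$ has nowhere vanishing leading coefficient; it is differentiated by the Leibniz rule with $\partial_x(e^{P}t^c)=P_x\,e^Pt^c$ and $\partial_t(e^Pt^c)=(P_t+c/t)\,e^Pt^c$. *)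

(* Defs.v *)
From HB Require Import structures.
From mathcomp Require Import all_boot all_order all_algebra.
From mathcomp Require Import all_classical all_reals all_analysis.
From mathcomp Require Import complex.
From mathcomp Require Import zify.

Set Implicit Arguments.
Unset Strict Implicit.
Unset Printing Implicit Defensive.

Import Order.TTheory GRing.Theory Num.Theory.
Import numFieldNormedType.Exports.

Local Open Scope ring_scope.
Local Open Scope classical_set_scope.

(* The field K((1/t)) of formal Laurent series in 1/t: [lcoef f k] is the
   coefficient of t^k, and only finitely many positive powers occur. *)

Record laurent (K : fieldType) := Laurent {
  lcoef :> int -> K;
  lcoef_bounded : exists N : int, forall k, N < k -> lcoef k = 0 }.

Section LaurentField.
Variable K : fieldType.
Local Notation L := (laurent K).

Lemma laurent_ext (f g : L) : (forall k, f k = g k) -> f = g.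
Proof.
case: f g => [f pf] [g pg] /= fg; have {}fg : f = g by apply/funext.
by move: pf pg; rewrite fg => pf pg; congr Laurent; exact: Prop_irrelevance.
Qed.

HB.instance Definition _ := gen_eqMixin L.
HB.instance Definition _ := gen_choiceMixin L.

Lemma lzero_bounded : exists N : int, forall k : int, N < k -> (0 : K) = 0.
Proof. by exists 0. Qed.
Definition lzero : L := Laurent lzero_bounded.

Lemma lopp_bounded (f : L) : exists N : int, forall k, N < k -> - f k = 0.
Proof. by case: (lcoef_bounded f) => N fN; exists N => k /fN ->; rewrite oppr0. Qed.
Definition lopp (f : L) : L := Laurent (lopp_bounded f).

Lemma common_bound (f g : L) :
  exists N : int, forall k, N < k -> f k = 0 /\ g k = 0.
Proof.
case: (lcoef_bounded f) (lcoef_bounded g) => M fM [N gN].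
by exists (Num.max M N) => k; rewrite gt_max => /andP[/fM -> /gN ->].
Qed.

Lemma ladd_bounded (f g : L) : exists N : int, forall k, N < k -> f k + g k = 0.
Proof.
by case: (common_bound f g) => N fgN; exists N => k /fgN[-> ->]; rewrite addr0.
Qed.
Definition ladd (f g : L) : L := Laurent (ladd_bounded f g).

Lemma laddA : associative ladd.
Proof. by move=> f g h; apply: laurent_ext => k /=; rewrite addrA. Qed.
Lemma laddC : commutative ladd.
Proof. by move=> f g; apply: laurent_ext => k /=; rewrite addrC. Qed.
Lemma ladd0 : left_id lzero ladd.
Proof. by move=> f; apply: laurent_ext => k /=; rewrite add0r. Qed.
Lemma laddN : left_inverse lzero lopp ladd.
Proof. by move=> f; apply: laurent_ext => k /=; rewrite addNr. Qed.

HB.instance Definition _ := GRing.isZmodule.Build L laddA laddC ladd0 laddN.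

(* A finitely supported sum. *)
Definition lmul_coef (f g : int -> K) (k : int) : K :=
  \sum_(i \in [set: int]) f i * g (k - i).

Lemma lmul_bounded (f g : L) :
  exists N : int, forall k, N < k -> lmul_coef f g k = 0.
Proof.
case: (lcoef_bounded f) (lcoef_bounded g) => M fM [N gN].
exists (M + N) => k kMN; apply: fsbig1 => i _.
have [/fM -> |iM] := ltP M i; first by rewrite mul0r.
by rewrite gN ?mulr0//; lia.
Qed.
Definition lmul (f g : L) : L := Laurent (lmul_bounded f g).

Lemma lmono_bounded (a : K) (n : int) :
  exists N : int, forall k, N < k -> (if k == n then a else 0) = 0.
Proof. by exists n => k nk; rewrite gt_eqF. Qed.
(* a t^n *)
Definition lmono (a : K) (n : int) : L := Laurent (lmono_bounded a n).

Local Definition lser_coef (M : int) (u : nat -> K) (k : int) : K :=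
  if k <= M then u `|M - k|%N else 0.

Lemma lser_bounded M u : exists N : int, forall k, N < k -> lser_coef M u k = 0.
Proof. by exists M => k Mk; rewrite /lser_coef leNgt Mk. Qed.
(* \sum_n u_n t^(M - n) *)
Definition lser (M : int) (u : nat -> K) : L := Laurent (lser_bounded M u).

Lemma lserE (f : L) (M : int) : (forall k, M < k -> f k = 0) ->
  f = lser M (fun n => f (M - n%:Z)).
Proof.
move=> fM; apply: laurent_ext => k; rewrite /= /lser_coef.
case: leP => [kM|/fM//]; congr (f _); lia.
Qed.

Lemma lserP (f : L) : exists M u, f = lser M u.
Proof.
by case: (lcoef_bounded f) => M /lserE ->; exists M, (fun n => f (M - n%:Z)).
Qed.

Definition conv (u v : nat -> K) (n : nat) : K :=
  \sum_(i < n.+1) u i * v (n - i)%N.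

Lemma convE u v N n : (n < N)%N ->
  conv u v n = ((\poly_(i < N) u i) * (\poly_(i < N) v i))`_n.
Proof.
move=> nN; rewrite coefM; apply: eq_bigr => i _.
by rewrite !coef_poly !ifT//; case: i => i /=; lia.
Qed.

Lemma convC u v n : conv u v n = conv v u n.
Proof. by rewrite !(@convE _ _ n.+1)// mulrC. Qed.

Lemma convA u v w n : conv u (conv v w) n = conv (conv u v) w n.
Proof.
transitivity ((\poly_(i < n.+1) u i * (\poly_(i < n.+1) v i
    * \poly_(i < n.+1) w i))`_n).
  rewrite coefM; apply: eq_bigr => -[i ilt] _ /=.
  by rewrite coef_poly ilt (@convE _ _ n.+1)//; lia.
rewrite mulrA coefM; apply: eq_bigr => -[i ilt] _ /=.
by rewrite coef_poly ifT ?(@convE _ _ n.+1)//; lia.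
Qed.

Lemma lmul_ser M N u v : lmul (lser M u) (lser N v) = lser (M + N) (conv u v).
Proof.
apply: laurent_ext => k; rewrite /= /lmul_coef.
rewrite [RHS]/lser_coef; case: leP => [kMN|kMN]; last first.
  apply: fsbig1 => i _; rewrite /lser_coef.
  case: (leP i M) => iM; last by rewrite mul0r.
  by rewrite leNgt (_ : N < k - i) ?mulr0//; lia.
rewrite (@fsbigE _ _ _ _ _
  [seq (M - i%:Z)%R | i <- iota 0 `|(M + N - k)%R|%N.+1]).
- rewrite big_map -{1}[`|_|%N.+1]subn0 -/(index_iota 0 _) big_mkord.
  apply: eq_big => [i|i _]; first by rewrite in_setT.
  rewrite /lser_coef !ifT; first by congr (u _ * v _); case: i => i /=; lia.
  + by case: i => i /=; lia.
  + by case: i => i /=; lia.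
- by rewrite map_inj_uniq ?iota_uniq// => i j; lia.
- by [].
move=> i _ iN; rewrite /lser_coef.
case: (leP i M) => iM; last by rewrite mul0r.
case: (leP (k - i) N) => kN; last by rewrite mulr0.
move/negP: iN; case; apply/mapP; exists `|M - i|%N; last by lia.
by rewrite mem_iota; lia.
Qed.

Lemma lser_add M u v : lser M u + lser M v = lser M (fun n => u n + v n).
Proof.
by apply: laurent_ext => k /=; rewrite /lser_coef; case: ifP; rewrite ?addr0.
Qed.

Lemma lmono_ser a n : lmono a n = lser n (fun i => if i == 0%N then a else 0).
Proof.
apply: laurent_ext => k /=; rewrite /lser_coef.
by case: (ltgtP k n) => [kn|kn|->] //; rewrite ?subrr//= ifF//; lia.
Qed.

Lemma lmulA : associative lmul.
Proof.
move=> f g h; case: (lserP f) (lserP g) (lserP h) => [M [u ->]] [N [v ->]].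
move=> [P [w ->]]; rewrite !lmul_ser addrA; congr lser.
by apply/funext => n; exact: convA.
Qed.

Lemma lmulC : commutative lmul.
Proof.
move=> f g; case: (lserP f) (lserP g) => [M [u ->]] [N [v ->]].
by rewrite !lmul_ser addrC; congr lser; apply/funext => n; exact: convC.
Qed.

Lemma lmul1 : left_id (lmono 1 0) lmul.
Proof.
move=> f; case: (lserP f) => [M [u ->]]; rewrite lmono_ser lmul_ser add0r.
congr lser; apply/funext => n; rewrite /conv big_ord_recl/= subn0 mul1r.
by rewrite big1 ?addr0// => i _; rewrite mul0r.
Qed.

Lemma lmulDl : left_distributive lmul +%R.
Proof.
move=> f g h; case: (common_bound f g) => N fgN.
rewrite (lserE (f := f) (M := N)); last by move=> k /fgN[].
rewrite (lserE (f := g) (M := N)); last by move=> k /fgN[].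
case: (lserP h) => [P [w ->]]; rewrite lser_add !lmul_ser lser_add.
congr lser; apply/funext => n; rewrite /conv -big_split/=.
by apply: eq_bigr => i _; rewrite mulrDl.
Qed.

Lemma lone_neq0 : lmono 1 0 != 0 :> L.
Proof.
apply/eqP => /(congr1 (fun f : L => f 0)) /=; apply/eqP; exact: oner_neq0.
Qed.

HB.instance Definition _ := GRing.Zmodule_isComNzRing.Build L
  lmulA lmulC lmul1 lmulDl lone_neq0.

Lemma conv_inv (u : nat -> K) : u 0%N != 0 ->
  exists v, forall n, conv u v n = if n == 0%N then 1 else 0.
Proof.
move=> u0.
pose nxt (s : seq K) : K := ((if size s == 0%N then 1 else 0)
  - \sum_(i < size s) u i.+1 * s`_(size s - i.+1)) / u 0%N.
pose pre n := iter n (fun s => rcons s (nxt s)) [::].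
have szpre n : size (pre n) = n by elim: n => //= n IH; rewrite size_rcons IH.
have prelt m n : (m < n)%N -> (pre n)`_m = nxt (pre m).
  elim: n => // n IH; rewrite ltnS leq_eqVlt => /orP[/eqP ->|mn] /=.
    by rewrite nth_rcons szpre ltnn eqxx.
  by rewrite nth_rcons szpre mn IH.
exists (fun n => nxt (pre n)) => n.
rewrite /conv big_ord_recl/= subn0 {1}/nxt szpre mulrC divfK//.
under [X in _ - X]eq_bigr => i _.
  rewrite (prelt (n - i.+1)%N n); last by case: i => i /=; lia.
  over.
by rewrite subrK.
Qed.

Lemma lser_lead (f : L) : f != 0 ->
  exists M u, u 0%N != 0 /\ f = lser M u.
Proof.
move=> f0; case: (lcoef_bounded f) => M fM.
have ex : exists n : nat, f (M - n%:Z) != 0.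
  apply: contrapT => nex; move/eqP: f0; apply; apply: laurent_ext => k /=.
  have [/fM //|kM] := ltP M k; apply: contrapT => /eqP fk.
  by apply: nex; exists `|M - k|%N; rewrite (_ : M - _ = k)//; lia.
case: (ex_minnP ex) => m fm mmin.
exists (M - m%:Z), (fun n => f (M - m%:Z - n%:Z)); split; first by rewrite subr0.
apply: lserE => k mk; have [/fM //|kM] := ltP M k.
apply: contrapT => /eqP fk; have := mmin `|M - k|%N.
by rewrite (_ : M - _ = k); [move=> /(_ fk)|]; lia.
Qed.

Lemma lmul_inv (f : L) : f != 0 -> exists g : L, g * f = 1.
Proof.
move=> /lser_lead[M [u [u0 ->]]]; have [v uv] := conv_inv u0.
exists (lser (- M) v); rewrite mulrC [LHS]lmul_ser subrr [RHS]lmono_ser.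
by congr lser; apply/funext.
Qed.

Definition linv (f : L) : L :=
  if pselect (exists g : L, g * f = 1) is left ex then projT1 (cid ex) else 0.

Lemma linvV (f : L) : f != 0 -> linv f * f = 1.
Proof.
move=> /lmul_inv ex; rewrite /linv; case: pselect => // ex'.
by case: cid.
Qed.

Lemma linv0 : linv 0 = 0.
Proof.
rewrite /linv; case: pselect => // ex; exfalso.
by case: ex => g; rewrite mulr0 => /eqP; rewrite eq_sym oner_eq0.
Qed.

HB.instance Definition _ := GRing.ComNzRing_isField.Build L linvV linv0.

Lemma lderiv_bounded (f : L) :
  exists N : int, forall k, N < k -> (k + 1)%:~R * f (k + 1) = 0.
Proof.
case: (lcoef_bounded f) => N fN; exists N => k Nk.
by rewrite fN ?mulr0//; lia.
Qed.
(* d/dt *)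
Definition lderiv (f : L) : L := Laurent (lderiv_bounded f).

(* The series with coefficients c; the junk value 0 is taken only when c has
   infinitely many nonzero coefficients of positive index. *)
Definition laurent_of (c : int -> K) : L :=
  if pselect (exists N : int, forall k, N < k -> c k = 0) is left b
  then Laurent b else 0.

End LaurentField.

Arguments lzero {K}.
Arguments lmono {K}.
Arguments lser {K}.

Notation "a %:L" := (lmono a 0) (at level 1, format "a %:L") : ring_scope.
Notation "''t'" := (lmono 1 1) (at level 0) : ring_scope.

(* As a canonical numClosedFieldType, so that the topology and the complex
   derivatives f^`() and f^`(n) of MathComp-Analysis apply. *)
Definition Cplx (R : realType) : numClosedFieldType := R[i].

Section FormalFunctions.
Variable R : realType.
Local Notation C := (Cplx R).
Implicit Types (D : set C) (x : C).

Definition domain D := [/\ open D, connected D & D !=set0].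

Definition holomorphic D (f : C -> C) := forall x, D x -> derivable f x 1.

(* An element of O((1/t)), O the ring of holomorphic functions on D, is
   represented by the family x |-> S x of its values in C((1/t)); two such
   families are the same series when they agree on D. *)
Definition holomorphic_laurent D (S : C -> laurent C) :=
  (exists N : int, forall x k, D x -> N < k -> S x k = 0) /\
  (forall k, holomorphic D (fun x => S x k)).

Definition nonvanishing_lead D (S : C -> laurent C) :=
  exists N : int, forall x, D x ->
    S x N != 0 /\ forall k, N < k -> S x k = 0.

(* d/dx and d/dt, termwise *)
Definition laurent_dx (S : C -> laurent C) : C -> laurent C :=
  fun x => laurent_of (fun k => (fun y => S y k)^`() x).

Definition laurent_dt (S : C -> laurent C) : C -> laurent C :=
  fun x => lderiv (S x).

Definition phase (P : {poly C -> C}) : C -> laurent C :=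
  fun x => \sum_(i < size P) (P`_i x)%:L * 't ^+ i.

(* exp(P) t^c S. The factor exp(P) t^c is carried by the type, so that sums
   and quotients of two expressions make sense when they share this factor. *)
Record formal_fun (P : {poly C -> C}) (c : C) := FormalFun {
  ampl : C -> laurent C }.

Section Operations.
Variables (P : {poly C -> C}) (c : C).
Local Notation FF := (formal_fun P c).

Definition is_formal_fun D (Y : FF) :=
  [/\ (forall i, holomorphic D P`_i), holomorphic_laurent D (ampl Y)
    & nonvanishing_lead D (ampl Y)].

Definition formal_dx (Y : FF) : FF := @FormalFun P c
  (fun x => laurent_dx (phase P) x * ampl Y x + laurent_dx (ampl Y) x).

Definition formal_dt (Y : FF) : FF := @FormalFun P c
  (fun x => (laurent_dt (phase P) x + c%:L / 't) * ampl Y x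
            + laurent_dt (ampl Y) x).

Definition formal_add (Y Z : FF) : FF :=
  @FormalFun P c (fun x => ampl Y x + ampl Z x).

Definition formal_scale (A : C -> laurent C) (Y : FF) : FF :=
  @FormalFun P c (fun x => A x * ampl Y x).

(* Y / Z: the common factor exp(P) t^c cancels *)
Definition formal_ratio (Y Z : FF) : C -> laurent C :=
  fun x => ampl Y x / ampl Z x.

(* A vector with entries exp(P) t^c S_i is represented by the column of its
   amplitudes S_i. *)
Definition col2 (Y1 Y2 : FF) (x : C) : 'cV[laurent C]_2 :=
  \col_i (if i == 0 then ampl Y1 x else ampl Y2 x).

End Operations.

Definition mat2 (A : pzRingType) (a b c d : A) : 'M[A]_2 :=
  \matrix_(i, j) (if i == 0 then (if j == 0 then a else b)
                  else (if j == 0 then c else d)).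

(* \sum_(n >= 0) a_n(x) t^(-n) *)
Definition series_at_infty (a : nat -> C -> C) : C -> laurent C :=
  fun x => lser 0 (fun n => a n x).

End FormalFunctions.

(* Main.v *)
(* Put [y = F/t]. The recursion for the [a_n] is the Riccati equation
   [y_x = t y - phi - psi y^2]. The defect [r] of the expected [t]-Riccati
   equation for [y] satisfies [r_x = (t - 2 psi y) r]; comparing leading powers
   of [t] gives [r = 0]. On a solution [Y_1 = e^P t^c S] the two logarithmic
   derivatives give [Y_2 = y Y_1], so both linear systems reduce to the two
   Riccati equations. For existence take [P = t^3/12 - x t/2] and
   [c = - alpha]: the equation in [t] then determines [S = 1 + O(1/t)] by an
   algebraic recursion, so no primitive in [x] is needed, and the equation in
   [x] follows because its defect, of negative degree in [t], solves a linear
   equation in [t] whose only such solution is 0. Part (ii) is part (i) with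
   [phi] and [psi] exchanged and [alpha] negated. *)

Require Import Defs.
From HB Require Import structures.
From mathcomp Require Import all_boot all_order all_algebra.
From mathcomp Require Import all_classical all_reals all_analysis.
From mathcomp Require Import zify ring.
Import Order.TTheory GRing.Theory Num.Theory.
Import numFieldNormedType.Exports.
Local Open Scope ring_scope.
Local Open Scope classical_set_scope.

(** * Coefficients, products and the derivation d/dt in K((1/t)) *)

Section LaurentSeries.
Set Implicit Arguments.
Unset Strict Implicit.
Variable K : fieldType.
Local Notation L := (laurent K).
Implicit Types (f g : L) (a b : K) (k m n : int).

Lemma lcoefD f g k : (f + g) k = f k + g k.
Proof. by []. Qed.

Lemma lcoefN f k : (- f) k = - f k.
Proof. by []. Qed.

Lemma lcoefMmono a n f k : (lmono a n * f) k = a * f (k - n).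
Proof.
change (lmul_coef (lmono a n) f k = a * f (k - n)).
rewrite /lmul_coef (@fsbigE _ _ _ _ _ [:: n]) //=.
- by rewrite big_cons big_nil in_setT addr0 eqxx.
- by move=> i _; case: eqP => [->|]; rewrite ?mem_seq1 ?eqxx ?mul0r.
Qed.

(** In every term of the convolution, one of the two indices exceeds its bound. The leading-term
    arguments below rest on this degree estimate. *)
Lemma lcoefM_eq0 f g m n : (forall k, m < k -> f k = 0) ->
  (forall k, n < k -> g k = 0) -> forall k, m + n < k -> (f * g) k = 0.
Proof.
move=> fm gn k mnk; apply: fsbig1 => i _.
have [/fm ->|im] := ltP m i; first by rewrite mul0r.
by rewrite gn ?mulr0//; lia.
Qed.

Lemma lserM M N (u v : nat -> K) : lser M u * lser N v = lser (M + N) (Defs.conv u v).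
Proof. exact: lmul_ser. Qed.

Lemma lser_coefE M (u : nat -> K) (n : nat) : lser M u (M - n%:Z) = u n.
Proof. by rewrite /= /Defs.lser_coef ifT; [congr u|]; lia. Qed.

Lemma lser_coef_gt M (u : nat -> K) k : M < k -> lser M u k = 0.
Proof. by move=> Mk; rewrite /= /Defs.lser_coef leNgt Mk. Qed.

Lemma lmonoM a b m n : lmono a m * lmono b n = lmono (a * b) (m + n).
Proof.
apply: laurent_ext => k; rewrite lcoefMmono /=.
by rewrite subr_eq (addrC n); case: eqP; rewrite ?mulr0.
Qed.

Lemma lmono1 : lmono 1 0 = 1 :> L.
Proof. by []. Qed.

Lemma lmonoD a b n : lmono (a + b) n = lmono a n + lmono b n.
Proof. by apply: laurent_ext => k /=; case: ifP; rewrite ?addr0. Qed.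

Lemma lmonoN a n : lmono (- a) n = - lmono a n.
Proof. by apply: laurent_ext => k /=; case: ifP; rewrite ?oppr0. Qed.

Lemma lmono0 n : lmono 0 n = 0 :> L.
Proof. by apply: laurent_ext => k /=; case: ifP. Qed.

Lemma lmono_nat (n : nat) : (n%:R)%:L = n%:R :> L.
Proof. by elim: n => [|n IH]; rewrite ?lmono0// !mulrS lmonoD IH. Qed.

Lemma lmonoV a : (a^-1)%:L = (a%:L)^-1 :> L.
Proof.
have [->|a0] := eqVneq a 0; first by rewrite invr0 !lmono0 invr0.
have aM : (a^-1)%:L * a%:L = 1 :> L by rewrite lmonoM mulVf.
have aL0 : a%:L != 0 :> L.
  by apply/eqP => aL0; move/eqP: aM; rewrite aL0 mulr0 eq_sym oner_eq0.
by apply: (mulIf aL0); rewrite aM mulVf.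
Qed.

Lemma lconstM a b : (a * b)%:L = a%:L * b%:L :> L.
Proof. by rewrite lmonoM addr0. Qed.

Lemma lmono_neq0 a n : a != 0 -> lmono a n != 0 :> L.
Proof.
move=> a0; apply/eqP => /(congr1 (fun f : L => f n)) /=.
by rewrite eqxx; apply/eqP.
Qed.

Lemma lmonoX a n (i : nat) : lmono a n ^+ i = lmono (a ^+ i) (n *+ i) :> L.
Proof. by elim: i => [|i IH] //; rewrite !exprS IH lmonoM mulrS. Qed.

(** The coefficient of t is [- b]. This justifies division by psi' - t psi. *)
Lemma linear_t_neq0 a b : b != 0 -> a%:L - 't * b%:L != 0 :> L.
Proof.
move=> b0; apply/eqP => /(congr1 (fun f : L => f 1)).
rewrite lcoefD lcoefN lcoefMmono mul1r subrr /= add0r => /eqP.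
by rewrite oppr_eq0 (negPf b0).
Qed.

Lemma lderivD f g : lderiv (f + g) = lderiv f + lderiv g.
Proof. by apply: laurent_ext => k /=; rewrite mulrDr. Qed.

Lemma lderivN f : lderiv (- f) = - lderiv f.
Proof. by apply: laurent_ext => k /=; rewrite mulrN. Qed.

Lemma lderiv_lser M (u : nat -> K) :
  lderiv (lser M u) = lser (M - 1) (fun n : nat => (M - n%:Z)%:~R * u n).
Proof.
apply: laurent_ext => k /=; rewrite /Defs.lser_coef.
have -> : (k <= M - 1) = (k + 1 <= M) by lia.
case: ifP => kM; last by rewrite mulr0.
by congr (_%:~R * u _); lia.
Qed.

(** With the factors written from exponents [M] and [N] downwards, the weight M + N - n splits as (M
    - i) + (N - (n - i)), one summand per factor. *)
Lemma lderivM f g : lderiv (f * g) = lderiv f * g + f * lderiv g.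
Proof.
case: (lserP f) (lserP g) => [M [u ->]] [N [v ->]].
rewrite !lderiv_lser !lserM lderiv_lser.
have -> : M - 1 + N = M + N - 1 by lia.
have -> : M + (N - 1) = M + N - 1 by lia.
rewrite lser_add; congr lser.
apply/funext => n; rewrite /Defs.conv mulr_sumr -big_split /=.
apply: eq_bigr => -[i /= ilt] _.
have -> : M + N - n%:Z = (M - i%:Z) + (N - (n - i)%N%:Z) by lia.
by rewrite intrD; ring.
Qed.

Lemma lderiv_mono a n : lderiv (lmono a n) = lmono (n%:~R * a) (n - 1).
Proof.
apply: laurent_ext => k /=; have -> : (k == n - 1) = (k + 1 == n) by lia.
by case: eqP => [->|]; rewrite ?mulr0.
Qed.

End LaurentSeries.

(** * Holomorphic functions on D and termwise x-derivatives of families of series *)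

Section Holomorphic.
Set Implicit Arguments.
Unset Strict Implicit.
Variable R : realType.
Local Notation C := (Cplx R).
Variable D : set C.
Hypothesis D_open : open D.
Implicit Types (f g : C -> C) (x : C) (S T : C -> laurent C).

(** As [D] is open, identities known only on [D] may be differentiated at its points. *)
Lemma near_domain (A : Type) (S T : C -> A) x :
  (forall y, D y -> S y = T y) -> D x -> \near x, S x = T x.
Proof.
move=> ST Dx; have : nbhs x D by exact: open_nbhs_nbhs.
by apply: filterS => y /ST.
Qed.

Lemma holomorphic_is_derive f x :
  holomorphic D f -> D x -> is_derive x 1 f (f^`() x).
Proof. by move=> hf Dx; rewrite derive1E; apply: DeriveDef; [exact: hf|by []]. Qed.

Lemma is_derive_derive1 f x (df : C) : is_derive x 1 f df -> f^`() x = df.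
Proof. by move=> h; rewrite derive1E derive_val. Qed.

Lemma eq_is_derive f g x (df dg : C) : (forall y, D y -> f y = g y) -> D x ->
  df = dg -> is_derive x 1 f df -> is_derive x 1 g dg.
Proof.
by move=> fg Dx <-; apply: near_eq_is_derive; exact: near_domain.
Qed.

Lemma eq_holomorphic f g :
  (forall y, D y -> f y = g y) -> holomorphic D f -> holomorphic D g.
Proof.
move=> fg hf x Dx.
by case: (eq_is_derive fg Dx erefl (holomorphic_is_derive hf Dx)).
Qed.

Lemma eq_derive1 f g x :
  (forall y, D y -> f y = g y) -> D x -> f^`() x = g^`() x.
Proof.
by move=> fg Dx; rewrite !derive1E; apply: near_eq_derive; exact: near_domain.
Qed.

Lemma is_derive_mul f g x (df dg : C) : is_derive x 1 f df ->
  is_derive x 1 g dg -> is_derive x 1 (fun y => f y * g y) (df * g x + f x * dg).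
Proof.
move=> hf hg; have := is_deriveM hf hg.
by rewrite addrC /GRing.scale /= (mulrC (g x)).
Qed.

Lemma is_derive_add f g x (df dg : C) : is_derive x 1 f df ->
  is_derive x 1 g dg -> is_derive x 1 (fun y => f y + g y) (df + dg).
Proof. by move=> hf hg; exact: is_deriveD. Qed.

Lemma is_derive_opp f x (df : C) : is_derive x 1 f df ->
  is_derive x 1 (fun y => - f y) (- df).
Proof. by move=> hf; exact: is_deriveN. Qed.

Lemma is_derive_const (c : C) x : is_derive x 1 (fun=> c) 0.
Proof. exact: is_derive_cst. Qed.

Lemma is_derive_var x : is_derive x 1 (fun y : C => y) 1.
Proof. exact: is_derive_id. Qed.

Lemma is_derive_bigsum (n : nat) (h : 'I_n -> C -> C) (dh : 'I_n -> C) x :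
  (forall i, is_derive x 1 (h i) (dh i)) ->
  is_derive x 1 (fun y => \sum_(i < n) h i y) (\sum_(i < n) dh i).
Proof.
move=> hh.
have -> : (fun y => \sum_(i < n) h i y) = \sum_(i < n) h i.
  by apply/funext => y; rewrite fct_sumE.
exact: is_derive_sum.
Qed.

(* Used in place of Cauchy's theorem: the equations for [phi''] and [psi'']
   bootstrap [phi], [psi], and hence all [a_n], into this class for every [n]. *)
Fixpoint Cn_holomorphic (n : nat) f : Prop :=
  holomorphic D f /\ (if n is m.+1 then Cn_holomorphic m f^`() else True).

Lemma Cn_holomorphic1 n f : Cn_holomorphic n f -> holomorphic D f.
Proof. by case: n => [|n] []. Qed.

Lemma Cn_holomorphic_eq n f g : (forall y, D y -> f y = g y) ->
  Cn_holomorphic n f -> Cn_holomorphic n g.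
Proof.
elim: n f g => [|n IH] f g fg [hf hf']; (split; first exact: eq_holomorphic fg hf).
  exact: I.
by apply: IH hf' => y; exact: eq_derive1.
Qed.

Lemma Cn_holomorphicW n f : Cn_holomorphic n.+1 f -> Cn_holomorphic n f.
Proof.
elim: n f => [|n IH] f [hf hf']; (split; first exact: hf); first exact: I.
exact: IH hf'.
Qed.

Lemma Cn_holomorphicD n f g : Cn_holomorphic n f -> Cn_holomorphic n g ->
  Cn_holomorphic n (fun y => f y + g y).
Proof.
elim: n f g => [|n IH] f g [hf hf'] [hg hg'].
  split; [move=> x Dx|exact: I].
  by case: (is_derive_add (holomorphic_is_derive hf Dx) (holomorphic_is_derive hg Dx)).
split=> [x Dx|].
  by case: (is_derive_add (holomorphic_is_derive hf Dx) (holomorphic_is_derive hg Dx)).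
apply: Cn_holomorphic_eq (IH _ _ hf' hg') => y Dy; apply/esym.
by apply: is_derive_derive1; apply: is_derive_add; exact: holomorphic_is_derive.
Qed.

Lemma Cn_holomorphicM n f g : Cn_holomorphic n f -> Cn_holomorphic n g ->
  Cn_holomorphic n (fun y => f y * g y).
Proof.
elim: n f g => [|n IH] f g hf hg.
  case: hf hg => hf _ [hg _].
  split; [move=> x Dx|exact: I].
  by case: (is_derive_mul (holomorphic_is_derive hf Dx) (holomorphic_is_derive hg Dx)).
have hf1 := Cn_holomorphic1 hf; have hg1 := Cn_holomorphic1 hg.
split=> [x Dx|].
  by case: (is_derive_mul (holomorphic_is_derive hf1 Dx) (holomorphic_is_derive hg1 Dx)).
(* Each summand of the product rule pairs a derivative of order [n] with an undifferentiated factor,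
   lowered from order n + 1 to [n]. *)
apply: Cn_holomorphic_eq
  (Cn_holomorphicD (IH _ _ hf.2 (Cn_holomorphicW hg))
                   (IH _ _ (Cn_holomorphicW hf) hg.2)) => y Dy; apply/esym.
by apply: is_derive_derive1; apply: is_derive_mul; exact: holomorphic_is_derive.
Qed.

Lemma Cn_holomorphic_cst n (c : C) : Cn_holomorphic n (fun=> c).
Proof.
have hc (d : C) : holomorphic D (fun=> d).
  by move=> x Dx; have [] := is_derive_const d x.
elim: n c => [|n IH] c; (split; first exact: hc); first exact: I.
apply: Cn_holomorphic_eq (IH 0) => y Dy; apply/esym.
exact: is_derive_derive1 (is_derive_const c y).
Qed.

Lemma Cn_holomorphic_id n : Cn_holomorphic n (fun y => y).
Proof.
have hid : holomorphic D (fun y => y).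
  by move=> x Dx; have [] := is_derive_var x.
case: n => [|n]; (split; first exact: hid); first exact: I.
apply: Cn_holomorphic_eq (Cn_holomorphic_cst n 1) => y Dy; apply/esym.
exact: is_derive_derive1 (is_derive_var y).
Qed.

Lemma Cn_holomorphic_sum n (I : Type) (r : seq I) (P : pred I)
  (h : I -> C -> C) : (forall i, P i -> Cn_holomorphic n (h i)) ->
  Cn_holomorphic n (fun y => \sum_(i <- r | P i) h i y).
Proof.
move=> hh; elim: r => [|i r IH].
  by apply: Cn_holomorphic_eq (Cn_holomorphic_cst n 0) => y _; rewrite big_nil.
case Pi : (P i); last first.
  by apply: Cn_holomorphic_eq IH => y _; rewrite big_cons Pi.
apply: Cn_holomorphic_eq (Cn_holomorphicD (hh i Pi) IH) => y _.
by rewrite big_cons Pi.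
Qed.

(** A relational form of termwise differentiation: it bypasses the default branch of [laurent_of],
    and its degree bound, uniform over [D], makes it stable under products. *)
Definition has_dx S T :=
  (exists N : int, forall x k, D x -> N < k -> S x k = 0) /\
  (forall k x, D x -> is_derive x 1 (fun y => S y k) (T x k)).

Lemma has_dx_holomorphic S T : has_dx S T -> holomorphic_laurent D S.
Proof. by case=> bS dS; split; [exact: bS|move=> k x Dx; case: (dS k x Dx)]. Qed.

Lemma laurent_ofE (f : laurent C) : laurent_of f = f.
Proof.
rewrite /laurent_of; case: pselect => [b|[]]; last exact: lcoef_bounded.
exact: laurent_ext.
Qed.

Lemma has_dxE S T x : has_dx S T -> D x -> laurent_dx S x = T x.
Proof.
case=> bS dS Dx; rewrite /laurent_dx -[RHS]laurent_ofE; congr laurent_of.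
by apply/funext => k; exact: is_derive_derive1 (dS k x Dx).
Qed.

Lemma holomorphic_has_dx S : holomorphic_laurent D S -> has_dx S (laurent_dx S).
Proof.
move=> [[N bS] hS]; split; first by exists N.
move=> k x Dx; rewrite /laurent_dx /laurent_of; case: pselect => [b /=|[]].
  exact: holomorphic_is_derive.
(* Above [N] the coefficients vanish on all of [D], hence so do their derivatives; this excludes the
   default value of [laurent_of]. *)
exists N => j Nj; rewrite (eq_derive1 (g := fun=> 0) _ Dx); last first.
  by move=> y Dy; exact: bS.
exact: is_derive_derive1 (is_derive_const 0 x).
Qed.

Lemma eq_has_dx S T S' T' : (forall x, D x -> S x = S' x) ->
  (forall x, D x -> T x = T' x) -> has_dx S T -> has_dx S' T'.
Proof.
move=> SS TT [[N bS] dS]; split.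
  by exists N => x k Dx; rewrite -SS//; exact: bS.
move=> k x Dx; apply: eq_is_derive (dS k x Dx); [|exact: Dx|by rewrite TT].
by move=> y Dy; rewrite SS.
Qed.

Lemma has_dxD S T S' T' : has_dx S T -> has_dx S' T' ->
  has_dx (fun x => S x + S' x) (fun x => T x + T' x).
Proof.
move=> [[M bS] dS] [[N bS'] dS']; split.
  exists (Num.max M N) => x k Dx; rewrite gt_max => /andP[Mk Nk].
  by rewrite lcoefD bS// bS'// addr0.
by move=> k x Dx; apply: is_derive_add; [exact: dS|exact: dS'].
Qed.

Lemma has_dxN S T : has_dx S T -> has_dx (fun x => - S x) (fun x => - T x).
Proof.
move=> [[M bS] dS]; split.
  by exists M => x k Dx Mk; rewrite lcoefN bS// oppr0.
by move=> k x Dx; apply: is_derive_opp; exact: dS.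
Qed.

Lemma dx_coef_eq0 S T (N : int) :
  (forall x k, D x -> N < k -> S x k = 0) ->
  (forall k x, D x -> is_derive x 1 (fun y => S y k) (T x k)) ->
  forall x k, D x -> N < k -> T x k = 0.
Proof.
move=> bS dS x k Dx Nk; rewrite -(is_derive_derive1 (dS k x Dx)).
rewrite (eq_derive1 (g := fun=> 0) _ Dx); last by move=> y Dy; exact: bS.
exact: is_derive_derive1 (is_derive_const 0 x).
Qed.

(** With uniform bounds [M] and [N], the coefficient of t^(M + N - n) is a sum of n + 1 products for
    every x in [D], so the product rule for finite sums applies. *)
Lemma has_dxM S T S' T' : has_dx S T -> has_dx S' T' ->
  has_dx (fun x => S x * S' x) (fun x => T x * S' x + S x * T' x).
Proof.
move=> [[M bS] dS] [[N bS'] dS']; split.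
  exists (M + N) => x; move=> k Dx.
  by apply: lcoefM_eq0 => j; [exact: bS|exact: bS'].
have bT x k : D x -> M < k -> T x k = 0 by exact: dx_coef_eq0.
have bT' x k : D x -> N < k -> T' x k = 0 by exact: dx_coef_eq0.
have mulE (U V : C -> laurent C) : (forall x k, D x -> M < k -> U x k = 0) ->
  (forall x k, D x -> N < k -> V x k = 0) -> forall x, D x -> U x * V x
  = lser (M + N) (Defs.conv (fun n => U x (M - n%:Z)) (fun n => V x (N - n%:Z))).
  move=> bU bV x Dx; rewrite (lserE (f := U x) (M := M)); last by move=> k; exact: bU.
  rewrite (lserE (f := V x) (M := N)); last by move=> k; exact: bV.
  by rewrite lserM; congr lser; apply/funext => n; apply: eq_bigr => i _;
    rewrite !lser_coefE.
move=> k x Dx.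
have [kMN|MNk] := leP k (M + N); last first.
  apply: (eq_is_derive (f := fun=> 0) _ Dx _ (is_derive_const 0 x)) => [y Dy|].
    by rewrite (@lcoefM_eq0 _ _ _ M N)// => j; [exact: bS|exact: bS'].
  rewrite lcoefD (@lcoefM_eq0 _ (T x) _ M N) ?(@lcoefM_eq0 _ (S x) _ M N) ?addr0//.
  - by move=> j; exact: bS.
  - by move=> j; exact: bT'.
  - by move=> j; exact: bT.
  - by move=> j; exact: bS'.
have -> : k = M + N - `|(M + N - k)%R|%N%:Z by lia.
set n := `|(M + N - k)%R|%N.
apply: (@eq_is_derive (fun y => \sum_(i < n.+1)
    S y (M - i%:Z) * S' y (N - (n - i)%N%:Z)) _ x
  (\sum_(i < n.+1) (T x (M - i%:Z) * S' x (N - (n - i)%N%:Z)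
     + S x (M - i%:Z) * T' x (N - (n - i)%N%:Z)))).
- by move=> y Dy; rewrite mulE// lser_coefE.
- exact: Dx.
- by rewrite !mulE// lcoefD !lser_coefE /Defs.conv big_split.
- by apply: is_derive_bigsum => i; apply: is_derive_mul; [exact: dS|exact: dS'].
Qed.

Lemma has_dx_mono f f' (n : int) : (forall x, D x -> is_derive x 1 f (f' x)) ->
  has_dx (fun x => lmono (f x) n) (fun x => lmono (f' x) n).
Proof.
move=> df; split; first by exists n => x k Dx nk /=; rewrite gt_eqF.
by move=> k x Dx /=; case: ifP => _; [exact: df|exact: is_derive_const].
Qed.

Lemma has_dx_cst (s : laurent C) : has_dx (fun=> s) (fun=> 0).
Proof.
split; first by have [N bs] := lcoef_bounded s; exists N => x k _; exact: bs.
by move=> k x Dx; exact: is_derive_const.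
Qed.

(** The two derivations commute because d/dt only shifts coefficients and multiplies them by
    integers. *)
Lemma has_dx_lderiv S T :
  has_dx S T -> has_dx (fun x => lderiv (S x)) (fun x => lderiv (T x)).
Proof.
move=> [[N bS] dS]; split.
  by exists N => x k Dx Nk /=; rewrite bS ?mulr0//; lia.
move=> k x Dx /=; have := is_derive_mul (is_derive_const ((k + 1)%:~R : C) x)
  (dS (k + 1) x Dx).
by rewrite mul0r add0r.
Qed.

End Holomorphic.

(** * Linear equations in t, solved power by power *)

Section LaurentEquations.
Variable K : fieldType.

(** The recursion is the coefficient form of S_t = Q S, where Q is the sum of the kap_n t^(-2-n). *)
Lemma conv_ode (kap : nat -> K) :
  (forall n : nat, (n.+1)%:R != 0 :> K) ->
  exists s : nat -> K, s 0%N = 1 /\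
    forall n : nat, (n.+1)%:R * s n.+1 = - Defs.conv kap s n.
Proof.
move=> char0.
(* Each term depends on all earlier ones, so the recursion runs on lists: [pre n] holds s_0, ...,
   s_n and [nxt] computes the next term from it. *)
pose nxt (s : seq K) : K :=
  - (\sum_(i < size s) kap i * s`_((size s).-1 - i)) / (size s)%:R.
pose pre n := iter n (fun s => rcons s (nxt s)) [:: 1].
have szpre n : size (pre n) = n.+1 by elim: n => //= n IH; rewrite size_rcons IH.
have preS n : (pre n.+1)`_n.+1 = nxt (pre n).
  by rewrite /= nth_rcons szpre ltnn eqxx.
have prelt m n : (m <= n)%N -> (pre n)`_m = (pre m)`_m.
  elim: n => [|n IH]; first by rewrite leqn0 => /eqP ->.
  rewrite leq_eqVlt => /orP[/eqP -> //|mn].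
  by rewrite -IH//= nth_rcons szpre mn.
exists (fun n => (pre n)`_n); split=> // n.
rewrite preS /nxt szpre mulrC divfK//; congr (- _); apply: eq_bigr => i _.
by rewrite prelt//= leq_subr.
Qed.

(** The constraint forces j = n - i, so the double sum in the recursion for the a_n is a Cauchy
    product. *)
Lemma convE_antidiagonal (u v : nat -> K) (n : nat) :
  \sum_(i < n.+2) \sum_(j < n.+2 | (i + j + 2 == n.+2)%N) u i * v j
  = Defs.conv u v n.
Proof.
(* The last index i = n + 1 admits no [j]. *)
rewrite big_ord_recr /= [X in _ + X]big1 ?addr0; last by move=> j; lia.
apply: eq_bigr => -[i ilt] _ /=.
have jlt : (n - i < n.+2)%N by lia.
by rewrite (big_pred1 (Ordinal jlt))// => j; rewrite /= -val_eqE /=; lia.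
Qed.

(** If [W] had top power t^(-m) with m >= 1, its coefficient times -m would appear at t^(-m-1) in
    W_t, whereas Q W has degree at most -m-2. *)
Lemma linear_dt_eq0 (W Q : laurent K) :
  (forall n : nat, (n.+1)%:R != 0 :> K) ->
  (forall k, -2 < k -> Q k = 0) -> (forall k, -1 < k -> W k = 0) ->
  lderiv W = Q * W -> W = 0.
Proof.
move=> char0 bQ bW dW.
suff vanish (n : nat) : forall k, -1 - n%:Z < k -> W k = 0.
  by apply: laurent_ext => k; rewrite (vanish `|k|%N.+1)//; lia.
elim: n => [|n IH] k nk; first by apply: bW; lia.
have [?|kn] := ltP (-1 - n%:Z) k; first exact: IH.
have kE : k = - n.+1%:Z by lia.
have := congr1 (fun f : laurent K => f (k - 1)) dW.
have QW0 : (Q * W) (k - 1) = 0 by apply: lcoefM_eq0 bQ IH _ _; lia.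
rewrite QW0 /= subrK => /eqP; rewrite mulf_eq0 => /orP[|/eqP//].
by rewrite kE rmorphN oppr_eq0 (negPf (char0 n)).
Qed.

Lemma lderiv_lser_conv (kap s : nat -> K) :
  (forall n : nat, (n.+1)%:R * s n.+1 = - Defs.conv kap s n) ->
  lderiv (lser 0 s) = lser (-2) kap * lser 0 s.
Proof.
move=> sS; rewrite lderiv_lser lserM addr0; apply: laurent_ext => k.
have [k1|k1] := ltP (-1) k; first by rewrite !lser_coef_gt//; lia.
(* The constant term has derivative 0, and the product starts only at t^(-2). *)
have [->|k0] := eqVneq k (-1).
  rewrite [RHS]lser_coef_gt// (_ : -1 = 0 - 1 - 0%:Z)//.
  by rewrite (lser_coefE (0 - 1) _ 0) subr0 mul0r.
have -> : k = - 2 - `|(- 2 - k)%R|%N%:Z by lia.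
set n := `|_|%N; rewrite lser_coefE.
have -> : - 2 - n%:Z = 0 - 1 - n.+1%:Z by lia.
by rewrite lser_coefE sub0r rmorphN mulNr sS opprK.
Qed.

Lemma lderiv_cst (c : K) : lderiv c%:L = 0.
Proof. by rewrite lderiv_mono mul0r lmono0. Qed.

Lemma lmono_div_t (c : K) : lmono c (-1) = c%:L / 't.
Proof.
apply: (mulIf (lmono_neq0 1 (oner_neq0 K))).
by rewrite divfK ?lmono_neq0 ?oner_neq0// lmonoM mulr1.
Qed.

Lemma lderiv_airy (c : K) : 12 != 0 :> K ->
  lderiv ('t * (- (c%:L * 2^-1)) + 't ^+ 3 * 12^-1) = 't ^+ 2 / 4 - c%:L / 2.
Proof.
move=> twelve_neq0.
have -> : 't * (- (c%:L * 2^-1)) + 't ^+ 3 * 12^-1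
    = - (lmono (c / 2) 1) + lmono 12^-1 3.
  rewrite -!lmono_nat -!lmonoV lmonoX mulrN !lmonoM.
  by rewrite expr1n !mul1r !addr0.
rewrite lderivD lderivN !lderiv_mono lmonoX -!lmono_nat -!lmonoV !lmonoM.
rewrite expr1n !mul1r subrr addr0 [RHS]addrC; congr (_ + lmono _ _).
(* What remains is 3/12 = 1/4, checked after multiplication by 12. *)
apply: (mulIf twelve_neq0); rewrite -mulrA mulVf// mulr1.
have e : 12 = 4 * 3 :> K by rewrite -natrM.
have four_neq0 : 4 != 0 :> K by apply: contraNneq twelve_neq0; rewrite e => ->; rewrite mul0r.
by rewrite e mulKf.
Qed.

End LaurentEquations.

(** * Rational identities behind the Riccati equations and the linear systems *)

(* Reading key: f, f1, g, g1 are phi, phi', psi, psi'; y, yx, yt are F/t and its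
   derivatives; s, s1 the amplitude of Y_1 and its derivative; p the derivative
   of the phase; al is alpha. *)
Section FieldIdentities.
Variable K : fieldType.
Implicit Types (t f g x y yx yt p s r v : K).

(** Here [r / s] is a logarithmic derivative; multiplication by g s / t solves the compatibility
    condition for [r]. *)
Lemma log_dx_eq t g y r s : 2 != 0 :> K -> t != 0 -> g != 0 -> s != 0 ->
  t * y = t / g * (r / s + t / 2) -> r = (g * y - t / 2) * s.
Proof.
move=> two_neq0 t0 g0 s0 /(congr1 (fun w => w * (g * s / t))) e.
have -> : (g * y - t / 2) * s = t * y * (g * s / t) - t / 2 * s.
  by field; rewrite t0 two_neq0.
by rewrite e; field; rewrite g0 s0 two_neq0 t0.
Qed.

Lemma log_dt_eq t g (g1 : K) v y r s :
  2 != 0 :> K -> t != 0 -> g1 - t * g != 0 -> s != 0 ->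
  t * y = 2 * t / (g1 - t * g) * (r / s + 4^-1 * (v - t ^+ 2)) ->
  r = ((g1 - t * g) / 2 * y - (v - t ^+ 2) / 4) * s.
Proof.
move=> two_neq0 t0 w0 s0 /(congr1 (fun w => w * ((g1 - t * g) * s / (2 * t)))) e.
have four_neq0 : 4 != 0 :> K by rewrite -[4%N]/(2 * 2)%N natrM mulf_neq0.
have -> : ((g1 - t * g) / 2 * y - (v - t ^+ 2) / 4) * s
    = t * y * ((g1 - t * g) * s / (2 * t)) - (v - t ^+ 2) / 4 * s.
  by field; rewrite four_neq0 t0 two_neq0.
by rewrite e; field; rewrite ?four_neq0 ?w0 ?s0 ?two_neq0 ?t0.
Qed.

(** Used for the constructed solution, where -t/2 is the x-derivative of the phase and g y s that of
    the amplitude. *)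
Lemma log_dx_solution t g y s : t != 0 -> g != 0 -> s != 0 ->
  t * y = t / g * ((- (t * 2^-1) * s + g * y * s) / s + t / 2).
Proof.
move=> t0 g0 s0.
by rewrite -mulrDl mulfK// addrAC addNr add0r mulrA divfK.
Qed.

(** The first bracket is P_t + c/t with c = - alpha; the second is S_t/S. *)
Lemma log_dt_solution t f g (g1 al : K) x y s :
  2 != 0 :> K -> t != 0 -> g1 - t * g != 0 -> s != 0 ->
  t * y = 2 * t / (g1 - t * g)
    * (((t ^+ 2 / 4 - x / 2 + - al / t) * s
        + ((g1 - t * g) * y * 2^-1 + g * f * 2^-1 + al / t) * s) / s
       + 4^-1 * (- 2 * g * f + 2 * x - t ^+ 2)).
Proof.
move=> two_neq0 t0 w0 s0.
have four_neq0 : 4 != 0 :> K by rewrite -[4%N]/(2 * 2)%N natrM mulf_neq0.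
by field; rewrite ?four_neq0 ?two_neq0 ?t0 ?w0 ?s0.
Qed.

(** This identity and the next two compare the coefficients of t^0, t^(-1) and t^(-2-n) in
    [reg_dtE]. *)
Lemma reg_coef_cst f g (g1 : K) :
  0 = 2^-1 * g1 * 0 - 2^-1 * g * f + g * f / 2 + 0.
Proof. by ring. Qed.

Lemma reg_coef_residue f (f1 : K) g (g1 al : K) : 2 != 0 :> K ->
  f1 * g - f * g1 = 2 * al ->
  0 = 2^-1 * g1 * f - 2^-1 * g * f1 + 0 + al.
Proof.
move=> two_neq0 /(congr1 ( *%R 2^-1)); rewrite mulKf// => <-.
by ring.
Qed.

Lemma reg_coef_tail g (g1 a1 a2 : K) :
  (g1 * a1 - g * a2) / 2 = 2^-1 * g1 * a1 - 2^-1 * g * a2.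
Proof. by ring. Qed.

(** For q = (psi' - t psi) y / 2 + psi phi / 2 + alpha / t this reads q_x = psi y_t, with y_x, psi''
    and y_t replaced by their equations. The zero terms are derivatives of constants left by the
    product rule. *)
Lemma reg_dx_identity t f (f1 : K) g (g1 : K) x y : 2 != 0 :> K ->
  (((- 2 * g * f + 2 * x) * g - (0 * g + t * g1)) * y
     + (g1 - t * g) * (t * y - f - g * y * y)) * 2^-1 + (g1 - t * g) * y * 0
    + ((g1 * f + g * f1) * 2^-1 + g * f * 0) + 0
  = g * ((t * f + f1) / 2 + (- (t ^+ 2 / 2) + x - g * f) * y
         + (t * g - g1) / 2 * y * y).
Proof. by move=> two_neq0; field. Qed.

(** The defect s1 - g y s of the x-equation obeys the same linear equation in t as [s]. *)
Lemma deriv_defect_identity g y yt s (s1 q : K) :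
  g * yt * s + q * s1 - ((0 * y + g * yt) * s + g * y * (q * s))
  = q * (s1 - g * y * s).
Proof. by ring. Qed.

Lemma wronskian_swap f (f1 : K) g (g1 al : K) :
  f1 * g - f * g1 = 2 * al -> g1 * f - g * f1 = 2 * - al.
Proof. by move=> e; rewrite mulrN -e opprB mulrC (mulrC g). Qed.

Lemma lower_left_opp t g (w al : K) (u : K) :
  g^-1 * ((- u - t) * w + - al) = - g^-1 * ((u + t) * w + al).
Proof. by rewrite -opprD mulNr -opprD mulrN mulNr. Qed.

(** Given the x-equation for Y_1, this is Y_2 = y Y_1. *)
Lemma snd_compE t g y s : g != 0 ->
  g^-1 * ((g * y - t / 2) * s + t / 2 * s) = y * s.
Proof. by move=> g0; rewrite -mulrDl subrK mulrA mulKf. Qed.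

(** Second row of the x-system: the product rule for y Y_1, then the Riccati equation in x and the
    first row. *)
Lemma snd_dx_eq t f g y yx p s (s1 : K) : 2 != 0 :> K ->
  yx = t * y - f - g * y * y -> p * s + s1 = (g * y - t / 2) * s ->
  p * (y * s) + (yx * s + y * s1) = - f * s + t / 2 * (y * s).
Proof.
move=> two_neq0 -> e; have -> : p * (y * s)
  + ((t * y - f - g * y * y) * s + y * s1)
  = y * (p * s + s1) + (t * y - f - g * y * y) * s by ring.
by rewrite e; field.
Qed.

Lemma fst_dt_eq t f g (g1 : K) x y s r : 2 != 0 :> K -> g != 0 ->
  r = ((g1 - t * g) / 2 * y - (- 2 * g * f + 2 * x - t ^+ 2) / 4) * s ->
  r = (t ^+ 2 / 4 - - g * f / 2 - x / 2) * s
      + - (g / 2) * (t + - g1 / g) * (y * s).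
Proof.
move=> two_neq0 g0 ->.
have four_neq0 : 4 != 0 :> K by rewrite -[4%N]/(2 * 2)%N natrM mulf_neq0.
by field; rewrite ?four_neq0 ?g0 ?two_neq0.
Qed.

(** Second row of the t-system. Writing alpha as half the Wronskian makes it a purely rational
    identity. *)
Lemma snd_dt_eq t f (f1 : K) g (g1 : K) x y yt p s (s1 : K) : 2 != 0 :> K -> g != 0 ->
  yt = (t * f + f1) / 2 + (- (t ^+ 2 / 2) + x - g * f) * y
       + (t * g - g1) / 2 * y * y ->
  p * s + s1 = ((g1 - t * g) / 2 * y - (- 2 * g * f + 2 * x - t ^+ 2) / 4) * s ->
  p * (y * s) + (yt * s + y * s1)
  = g^-1 * ((- g1 / g - t) * (- g * f / 2) + (f1 * g - f * g1) / 2) * s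
    + (- (t ^+ 2 / 4) + - g * f / 2 + x / 2) * (y * s).
Proof.
move=> two_neq0 g0 -> e.
have four_neq0 : 4 != 0 :> K by rewrite -[4%N]/(2 * 2)%N natrM mulf_neq0.
set yt' := (X in _ + (X * s + _)).
have -> : p * (y * s) + (yt' * s + y * s1) = y * (p * s + s1) + yt' * s by ring.
by rewrite e /yt'; field; rewrite ?four_neq0 ?g0 ?two_neq0.
Qed.

Lemma col2_eq_mulmx (A : pzRingType) (a b c d p q r s : A) :
  p = a * r + b * s -> q = c * r + d * s ->
  \col_(i < 2) (if i == 0 then p else q)
  = mat2 a b c d *m \col_(i < 2) (if i == 0 then r else s).
Proof.
move=> -> ->; apply/matrixP => i j; rewrite !mxE big_ord_recl big_ord1 !mxE /=.
by case: ifP.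
Qed.

(** The left side is r_x for the defect r of the Riccati equation in t: first y_xt, then the
    derivative of the expected right side with y_x, phi'' and psi'' substituted. *)
Lemma riccati_identity t f (f1 : K) g (g1 : K) x y yt : 2 != 0 :> K ->
  y + t * yt - 2 * g * y * yt
  - ((0 * f + t * f1 + (-2 * g * f + 2 * x) * f) / 2 + (t * f + f1) * 0
     + ((0 + 1 - (g1 * f + g * f1)) * y
        + (- (t ^+ 2 / 2) + x - g * f) * (t * y - f - g * y * y))
     + ((((0 * g + t * g1 - (-2 * g * f + 2 * x) * g) / 2 + (t * g - g1) * 0) * y
          + (t * g - g1) / 2 * (t * y - f - g * y * y)) * y
        + (t * g - g1) / 2 * y * (t * y - f - g * y * y)))
  = (t + -2 * g * y)
    * (yt - ((t * f + f1) / 2 + (- (t ^+ 2 / 2) + x - g * f) * y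
             + (t * g - g1) / 2 * y * y)).
Proof. by move=> two_neq0; field. Qed.

End FieldIdentities.

(** * The two Riccati equations for y = F/t *)

Section Riccati.
Set Implicit Arguments.
Unset Strict Implicit.
Variable R : realType.
Local Notation C := (Cplx R).
Local Notation L := (laurent C).
Variables (D : set C) (D_open : open D).

(** A top coefficient of [S] would reappear one power higher in t S, where neither S_x nor U S
    reaches. The descent treats all x in [D] at once, since vanishing must be differentiated. *)
Lemma linear_dx_eq0 (S U : C -> L) :
  (forall x k, D x -> -1 < k -> U x k = 0) ->
  has_dx D S (fun x => ('t + U x) * S x) -> forall x, D x -> S x = 0.
Proof.
move=> bU [[N bS] dS].
suff vanish (n : nat) : forall x k, D x -> N - n%:Z < k -> S x k = 0.
  move=> x Dx; apply: laurent_ext => k; rewrite (vanish `|(N - k)%R|%N.+1)//; lia.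
elim: n => [|n IH] x k Dx Nk; first by apply: bS => //; lia.
have [?|kN] := ltP (N - n%:Z) k; first exact: IH.
have kE : k = N - n%:Z by lia.
have := dx_coef_eq0 D_open IH dS (k := k + 1) Dx.
rewrite mulrDl lcoefD lcoefMmono mul1r addrK.
rewrite (@lcoefM_eq0 _ _ _ (-1) (N - n%:Z)) ?addr0; first by apply; lia.
- by move=> j; exact: bU.
- by move=> j; exact: IH.
- lia.
Qed.

Variables (phi psi : C -> C) (alpha : C) (a : nat -> C -> C).
Hypothesis hphi : holomorphic D phi.
Hypothesis hpsi : holomorphic D psi.
Hypothesis hphi' : holomorphic D (derive1 phi).
Hypothesis hpsi' : holomorphic D (derive1 psi).
Hypothesis phi_neq0 : forall x, D x -> phi x != 0.
Hypothesis psi_neq0 : forall x, D x -> psi x != 0.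
Hypothesis ode_psi : forall x, D x ->
  derive1n 2 psi x / psi x = - 2 * psi x * phi x + 2 * x.
Hypothesis ode_phi : forall x, D x ->
  derive1n 2 phi x / phi x = - 2 * psi x * phi x + 2 * x.
Hypothesis wronskian : forall x, D x ->
  derive1 phi x * psi x - phi x * derive1 psi x = 2 * alpha.
Hypothesis a0 : forall x, D x -> a 0%N x = phi x.
Hypothesis aS : forall n x, (1 <= n)%N -> D x ->
  a n x = derive1 (a n.-1) x
    + psi x * \sum_(i < n) \sum_(j < n | (i + j + 2 == n)%N) a i x * a j x.

Lemma phi_dd x : D x -> derive1 (derive1 phi) x = (- 2 * psi x * phi x + 2 * x) * phi x.
Proof. by move=> Dx; rewrite -ode_phi// divfK// phi_neq0. Qed.

Lemma psi_dd x : D x -> derive1 (derive1 psi) x = (- 2 * psi x * phi x + 2 * x) * psi x.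
Proof. by move=> Dx; rewrite -ode_psi// divfK// psi_neq0. Qed.

(** All four go together: phi'' and psi'' are polynomials in x, phi and psi, so order [n] for the
    functions raises their derivatives to order n + 1, and conversely. *)
Lemma Cn_holomorphic_phi_psi n :
  [/\ Cn_holomorphic D n phi, Cn_holomorphic D n (derive1 phi),
      Cn_holomorphic D n psi & Cn_holomorphic D n (derive1 psi)].
Proof.
elim: n => [|n [h1 h2 h3 h4]].
  by split; (split; last exact: I).
have hv : Cn_holomorphic D n (fun x => - 2 * psi x * phi x + 2 * x).
  have hc c := Cn_holomorphic_cst D_open n c.
  apply: (Cn_holomorphicD D_open); apply: (Cn_holomorphicM D_open).
  - exact: (Cn_holomorphicM D_open (hc _) h3).
  - exact: h1.
  - exact: hc.
  - exact: (Cn_holomorphic_id D_open).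
split; [exact: (conj hphi h2)| |exact: (conj hpsi h4)| ].
- split; first exact: hphi'.
  by apply: (Cn_holomorphic_eq D_open _ (Cn_holomorphicM D_open hv h1)) => x Dx;
    rewrite phi_dd.
- split; first exact: hpsi'.
  by apply: (Cn_holomorphic_eq D_open _ (Cn_holomorphicM D_open hv h3)) => x Dx;
    rewrite psi_dd.
Qed.

Lemma Cn_holomorphic_coef m n : Cn_holomorphic D n (a m).
Proof.
(* The order [n] stays general: a_(m+1) to order [n] involves a_m', hence a_m to order n + 1. *)
elim/ltn_ind: m n => -[_|m IH] n.
  have [hphin _ _ _] := Cn_holomorphic_phi_psi n.
  by apply: (Cn_holomorphic_eq D_open _ hphin) => x Dx; rewrite a0.
have [_ _ hpsin _] := Cn_holomorphic_phi_psi n.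
apply: (Cn_holomorphic_eq D_open (f := fun x => derive1 (a m) x
  + psi x * \sum_(i < m.+1) \sum_(j < m.+1 | (i + j + 2 == m.+1)%N) a i x * a j x)).
  by move=> x Dx; rewrite aS.
apply: (Cn_holomorphicD D_open); first by case: (IH m (ltnSn m) n.+1).
apply: (Cn_holomorphicM D_open hpsin).
apply: (Cn_holomorphic_sum D_open) => i _.
apply: (Cn_holomorphic_sum D_open) => j _.
by apply: (Cn_holomorphicM D_open); apply: IH.
Qed.

Lemma coef1 x : D x -> a 1%N x = derive1 phi x.
Proof.
move=> Dx; rewrite aS// (eq_derive1 D_open a0)//.
by rewrite big1 ?mulr0 ?addr0// => i _; rewrite big1// => j; lia.
Qed.

Lemma coefSS n x : D x ->
  a n.+2 x = derive1 (a n.+1) x + psi x * Defs.conv (a^~ x) (a^~ x) n.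
Proof.
move=> Dx; rewrite aS//; congr (_ + _ * _).
exact: convE_antidiagonal.
Qed.

Definition riccati_sol (x : C) : L := lser (-1) (fun n => a n x).
Definition riccati_dx (x : C) : L := lser (-1) (fun n => derive1 (a n) x).
Local Notation y := riccati_sol.

Lemma series_at_inftyE x : series_at_infty a x = 't * y x.
Proof.
apply: laurent_ext => k; rewrite lcoefMmono mul1r /= /Defs.lser_coef.
have -> : (k - 1 <= -1) = (k <= 0) by lia.
by case: ifP => // k0; congr a; lia.
Qed.

Lemma has_dx_riccati_sol : has_dx D y riccati_dx.
Proof.
split; first by exists (-1) => x k _; exact: lser_coef_gt.
move=> k x Dx; rewrite /y /riccati_dx /= /Defs.lser_coef.
case: ifP => _; last exact: is_derive_const.
apply: holomorphic_is_derive Dx.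
exact: Cn_holomorphic1 (Cn_holomorphic_coef _ 0).
Qed.

(** Power by power: t^0 gives a_0 = phi, t^(-1) gives a_1 = a_0', and t^(-2-n) is the recursion for
    a_(n+2). *)
Lemma riccati_dxE x : D x ->
  riccati_dx x = 't * y x - (phi x)%:L - (psi x)%:L * y x * y x.
Proof.
move=> Dx; apply: laurent_ext => k.
rewrite -mulrA lserM !lcoefD !lcoefN !lcoefMmono mul1r subr0.
have [k1|k1] := ltP 0 k.
  rewrite !lser_coef_gt ?mulr0; try lia.
  by rewrite /= gt_eqF// !subr0.
have [->|k0] := eqVneq k 0.
  rewrite lser_coef_gt// /= /Defs.lser_coef /= a0//.
  by rewrite mulr0 subr0 subrr.
have [->|k2] := eqVneq k (-1).
  by rewrite /= /Defs.lser_coef /= coef1// (eq_derive1 D_open a0)// mulr0 !subr0.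
have -> : k = - 2 - `|(- 2 - k)%R|%N%:Z by lia.
set n := `|_|%N; rewrite lser_coefE.
have -> : - 2 - n%:Z - 1 = - 1 - n.+2%:Z by lia.
have -> : - 2 - n%:Z = - 1 - n.+1%:Z by lia.
by rewrite !lser_coefE coefSS//= subr0 addrK.
Qed.

Lemma has_dx_phi : has_dx D (fun x => (phi x)%:L) (fun x => (derive1 phi x)%:L).
Proof. apply: has_dx_mono => x; exact: holomorphic_is_derive hphi. Qed.

Lemma has_dx_psi : has_dx D (fun x => (psi x)%:L) (fun x => (derive1 psi x)%:L).
Proof. apply: has_dx_mono => x; exact: holomorphic_is_derive hpsi. Qed.

Lemma lmono_potential x (f : C) : ((- 2 * psi x * phi x + 2 * x) * f)%:L
  = (- 2 * (psi x)%:L * (phi x)%:L + 2 * x%:L) * f%:L :> L.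
Proof.
by rewrite !(lconstM, lmonoD, lmonoN, lmono_nat).
Qed.

Lemma has_dx_dphi : has_dx D (fun x => (derive1 phi x)%:L)
  (fun x => (- 2 * (psi x)%:L * (phi x)%:L + 2 * x%:L) * (phi x)%:L).
Proof.
have h : has_dx D (fun x => (derive1 phi x)%:L)
    (fun x => (derive1 (derive1 phi) x)%:L).
  by apply: has_dx_mono => x; exact: holomorphic_is_derive hphi'.
apply: (eq_has_dx D_open _ _ h) => // x Dx.
by rewrite phi_dd// lmono_potential.
Qed.

Lemma has_dx_dpsi : has_dx D (fun x => (derive1 psi x)%:L)
  (fun x => (- 2 * (psi x)%:L * (phi x)%:L + 2 * x%:L) * (psi x)%:L).
Proof.
have h : has_dx D (fun x => (derive1 psi x)%:L)
    (fun x => (derive1 (derive1 psi) x)%:L).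
  by apply: has_dx_mono => x; exact: holomorphic_is_derive hpsi'.
apply: (eq_has_dx D_open _ _ h) => // x Dx.
by rewrite psi_dd// lmono_potential.
Qed.

Lemma has_dx_x : has_dx D (fun x => x%:L) (fun=> 1).
Proof. by apply: (has_dx_mono (f' := fun=> 1)) => x Dx; exact: is_derive_var. Qed.

Lemma two_neq0 : 2 != 0 :> L.
Proof. by rewrite -(lmono_nat _ 2) lmono_neq0// pnatr_eq0. Qed.

Lemma riccati_dtE x : D x ->
  lderiv (y x) = ('t * (phi x)%:L + (derive1 phi x)%:L) / 2
    + (- ('t ^+ 2 / 2) + x%:L - (psi x)%:L * (phi x)%:L) * y x
    + ('t * (psi x)%:L - (derive1 psi x)%:L) / 2 * y x * y x.
Proof.
move=> Dx; apply/eqP; rewrite -subr_eq0; apply/eqP; move: x Dx.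
(* The factor t - 2 psi y is t + [U] with [U] of degree at most -1, as [linear_dx_eq0] requires. *)
pose U x : L := - 2 * (psi x)%:L * y x.
apply: (@linear_dx_eq0 _ U).
  move=> x k Dx k1; rewrite /U.
  apply: (@lcoefM_eq0 _ _ _ 0 (-1)) => // j j0.
    rewrite -(lmono_nat _ 2) -lmonoN lcoefMmono subr0 /= gt_eqF ?mulr0//.
  exact: lser_coef_gt.
have hy := has_dx_riccati_sol.
have hyt := has_dx_lderiv hy.
have hc (s : L) := has_dx_cst D s.
(* [hA], [hB] and [hC] differentiate the coefficients of 1, y and y^2 on the expected right side. *)
have hA := has_dxM D_open (has_dxD (has_dxM D_open (hc 't) has_dx_phi) has_dx_dphi)
  (hc 2^-1).
have hB := has_dxD (has_dxD (hc (- ('t ^+ 2 / 2))) has_dx_x)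
  (has_dxN (has_dxM D_open has_dx_psi has_dx_phi)).
have hC := has_dxM D_open (has_dxD (has_dxM D_open (hc 't) has_dx_psi)
  (has_dxN has_dx_dpsi)) (hc 2^-1).
have hR := has_dxD hyt (has_dxN (has_dxD (has_dxD hA (has_dxM D_open hB hy))
  (has_dxM D_open (has_dxM D_open hC hy) hy))).
apply: (eq_has_dx D_open _ _ hR) => // x Dx.
(* The mixed derivative y_xt is computed by applying d/dt to the Riccati equation in x. *)
have dyx : lderiv (riccati_dx x) = y x + 't * lderiv (y x)
    - 2 * (psi x)%:L * y x * lderiv (y x).
  rewrite riccati_dxE// !lderivD !lderivN !lderivM !lderiv_mono.
  by rewrite !mul0r !lmono0 !mulr1 subrr lmono1; ring.
rewrite dyx riccati_dxE// /U.
exact: riccati_identity two_neq0.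
Qed.

Lemma lconst_quot (f g : C) : (f / g)%:L = f%:L / g%:L :> L.
Proof. by rewrite lconstM lmonoV. Qed.

Lemma t_neq0 : 't != 0 :> L.
Proof. by apply: lmono_neq0; exact: oner_neq0. Qed.

Lemma psiL_neq0 x : D x -> (psi x)%:L != 0 :> L.
Proof. by move=> Dx; apply: lmono_neq0; exact: psi_neq0. Qed.

Lemma dpsi_tpsi_neq0 x : D x ->
  (derive1 psi x)%:L - 't * (psi x)%:L != 0 :> L.
Proof.
by move=> Dx; apply: linear_t_neq0; exact: psi_neq0.
Qed.

Lemma lmono_ode_psi x : D x -> (derive1n 2 psi x / psi x)%:L
  = - 2 * (psi x)%:L * (phi x)%:L + 2 * x%:L :> L.
Proof.
by move=> Dx; rewrite ode_psi// !(lconstM, lmonoD, lmonoN, lmono_nat).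
Qed.

(** * From the compatibility conditions to the two linear systems *)

Definition log_dx_compatible (P : {poly C -> C}) (c : C) (Y1 : formal_fun P c) :=
  forall x, D x -> series_at_infty a x
    = 't / (psi x)%:L * (formal_ratio (formal_dx Y1) Y1 x + 't / 2).

Definition log_dt_compatible (P : {poly C -> C}) (c : C) (Y1 : formal_fun P c) :=
  forall x, D x -> series_at_infty a x
    = 2 * 't / ((derive1 psi x)%:L - 't * (psi x)%:L)
      * (formal_ratio (formal_dt Y1) Y1 x
         + 4^-1 * ((derive1n 2 psi x / psi x)%:L - 't ^+ 2)).

(** Kept abstract so that the result also applies after exchanging phi and psi, with - u_0 in the
    role of u_(-1). *)
Variables (z u : C -> C).
Hypothesis zE : forall x, D x -> z x = - psi x * phi x.
Hypothesis uE : forall x, D x -> u x = - derive1 psi x / psi x.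

Lemma formal_system (P : {poly C -> C}) (c : C) (Y1 : formal_fun P c) :
  is_formal_fun D Y1 -> log_dx_compatible Y1 -> log_dt_compatible Y1 ->
  let Y2 := formal_scale (fun x => (psi x)%:L^-1)
    (formal_add (formal_dx Y1) (formal_scale (fun=> 't / 2) Y1)) in
  forall x, D x ->
    col2 (formal_dt Y1) (formal_dt Y2) x
    = mat2 ('t ^+ 2 / 4 - (z x)%:L / 2 - x%:L / 2)
           (- ((psi x)%:L / 2) * ('t + (u x)%:L))
           ((psi x)%:L^-1
            * (((u x)%:L - 't) * ((z x)%:L / 2) + alpha%:L))
           (- ('t ^+ 2 / 4) + (z x)%:L / 2 + x%:L / 2)
      *m col2 Y1 Y2 x
    /\
    col2 (formal_dx Y1) (formal_dx Y2) x
    = mat2 (- ('t / 2)) (psi x)%:L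
           (z x / psi x)%:L ('t / 2)
      *m col2 Y1 Y2 x.
Proof.
move=> [_ hS [N leadS]] cdx cdt Y2.
have S_neq0 x : D x -> ampl Y1 x != 0.
  move=> Dx; have [SN _] := leadS x Dx.
  by apply: contraNneq SN => ->.
have dxE x : D x -> ampl (formal_dx Y1) x = ((psi x)%:L * y x - 't / 2) * ampl Y1 x.
  move=> Dx; apply: log_dx_eq two_neq0 t_neq0 (psiL_neq0 Dx) (S_neq0 x Dx) _.
  by rewrite -series_at_inftyE cdx.
have dtE x : D x -> ampl (formal_dt Y1) x
    = (((derive1 psi x)%:L - 't * (psi x)%:L) / 2 * y x
       - (- 2 * (psi x)%:L * (phi x)%:L + 2 * x%:L - 't ^+ 2) / 4) * ampl Y1 x.
  move=> Dx; apply: log_dt_eq two_neq0 t_neq0 (dpsi_tpsi_neq0 Dx) (S_neq0 x Dx) _.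
  by rewrite -series_at_inftyE cdt// lmono_ode_psi.
have Y2E x : D x -> ampl Y2 x = y x * ampl Y1 x.
  move=> Dx; rewrite [LHS]/(_^-1 * (ampl (formal_dx Y1) x + 't / 2 * ampl Y1 x)).
  by rewrite dxE//; exact: snd_compE (psiL_neq0 Dx).
have hdS := holomorphic_has_dx D_open hS.
(* Agreement of [ampl Y2] with y times [ampl Y1] on the open set [D] suffices to differentiate
   it. *)
have hdY2 : has_dx D (ampl Y2)
    (fun x => riccati_dx x * ampl Y1 x + y x * laurent_dx (ampl Y1) x).
  apply: (eq_has_dx D_open _ _ (has_dxM D_open has_dx_riccati_sol hdS)) => // x Dx.
  by rewrite Y2E.
move=> x Dx.
have zL : (z x)%:L = - (psi x)%:L * (phi x)%:L :> L.
  by rewrite zE// lconstM lmonoN.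
have uL : (u x)%:L = - (derive1 psi x)%:L / (psi x)%:L :> L.
  by rewrite uE// lconst_quot// lmonoN.
have alphaL : alpha%:L = ((derive1 phi x)%:L * (psi x)%:L
    - (phi x)%:L * (derive1 psi x)%:L) / 2 :> L.
  rewrite -!lconstM -lmonoN -lmonoD wronskian// lconstM lmono_nat mulrC mulKf//.
  exact: two_neq0.
have psi0 := psiL_neq0 Dx.
split.
- rewrite /col2 Y2E//; apply: col2_eq_mulmx.
  + rewrite zL uL; apply: fst_dt_eq two_neq0 psi0 _; exact: dtE.
  + rewrite zL uL alphaL [LHS]/((laurent_dt (phase P) x + c%:L / 't) * ampl Y2 x
      + lderiv (ampl Y2 x)) Y2E// lderivM.
    apply: snd_dt_eq two_neq0 psi0 (riccati_dtE Dx) _; exact: dtE.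
- rewrite /col2 Y2E//; apply: col2_eq_mulmx.
  + by rewrite dxE// mulrDl addrC -mulrA mulNr.
  + have -> : (z x / psi x)%:L = - (phi x)%:L :> L.
      by rewrite lconst_quot// zL mulNr mulrC mulrN mulKf.
    rewrite [LHS]/(laurent_dx (phase P) x * ampl Y2 x + laurent_dx (ampl Y2) x).
    rewrite (has_dxE hdY2 Dx) Y2E//.
    apply: snd_dx_eq two_neq0 (riccati_dxE Dx) _; exact: dxE.
Qed.

(** * Construction of a formal solution *)

(* Coefficients of S_t / S, i.e. of Y_t / Y stripped of e^P t^(-alpha). *)
Definition reg_coef (n : nat) (x : C) : C :=
  (derive1 psi x * a n.+1 x - psi x * a n.+2 x) / 2.

Definition reg_dt (x : C) : L := lser (-2) (fun n => reg_coef n x).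

Lemma two_neq0C : 2 != 0 :> C.
Proof. by rewrite pnatr_eq0. Qed.

(** The right side is Y_t/Y minus P_t + c/t. Its t^0 terms cancel because a_0 = phi, its t^(-1)
    terms by the Wronskian relation with c = - alpha; hence S_t/S starts at t^(-2) and S can be a
    power series in 1/t. *)
Lemma reg_dtE x : D x -> reg_dt x
  = ((derive1 psi x)%:L - 't * (psi x)%:L) * y x * 2^-1
    + (psi x)%:L * (phi x)%:L * 2^-1 + lmono alpha (-1).
Proof.
move=> Dx; apply: laurent_ext => k; rewrite -(lmono_nat _ 2) -lmonoV !lmonoM mul1r addr0 add0r.
rewrite mulrC mulrBl mulrBr !mulrA !lmonoM !addr0 add0r.
rewrite !lcoefD lcoefN !lcoefMmono subr0.
have [k1|k1] := ltP 0 k.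
  by rewrite !lser_coef_gt ?mulr0 /= ?gt_eqF ?subrr ?addr0//; lia.
have [->|k0] := eqVneq k 0.
  rewrite lser_coef_gt// /= /Defs.lser_coef /= a0//.
  exact: (@reg_coef_cst C (phi x) (psi x) (derive1 psi x)).
have [->|k2] := eqVneq k (-1).
  rewrite lser_coef_gt// /= /Defs.lser_coef /= a0// coef1//.
  exact: reg_coef_residue two_neq0C (wronskian Dx).
have -> : k = - 2 - `|(- 2 - k)%R|%N%:Z by lia.
set n := `|_|%N; rewrite lser_coefE.
have -> : - 2 - n%:Z - 1 = - 1 - n.+2%:Z by lia.
have -> : - 2 - n%:Z = - 1 - n.+1%:Z by lia.
rewrite !lser_coefE /= !addr0 /reg_coef.
exact: (@reg_coef_tail C (psi x) (derive1 psi x) (a n.+1 x) (a n.+2 x)).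
Qed.

Lemma Cn_holomorphic_reg_coef n : Cn_holomorphic D 1 (reg_coef n).
Proof.
have [_ _ h1 h2] := Cn_holomorphic_phi_psi 1.
have hc := Cn_holomorphic_cst D_open 1.
apply: (Cn_holomorphic_eq D_open (f := fun x => (derive1 psi x * a n.+1 x
  + (-1) * (psi x * a n.+2 x)) * 2^-1)).
  by move=> x Dx; rewrite mulN1r.
apply: (Cn_holomorphicM D_open); last exact: hc.
apply: (Cn_holomorphicD D_open).
  exact: (Cn_holomorphicM D_open h2 (Cn_holomorphic_coef _ _)).
apply: (Cn_holomorphicM D_open); first exact: hc.
exact: (Cn_holomorphicM D_open h1 (Cn_holomorphic_coef _ _)).
Qed.

Lemma succ_neq0 n : (n.+1)%:R != 0 :> C.
Proof. by rewrite pnatr_eq0. Qed.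

Lemma has_dx_lser M (s : nat -> C -> C) : (forall n, holomorphic D (s n)) ->
  has_dx D (fun x => lser M (s^~ x)) (fun x => lser M (fun n => derive1 (s n) x)).
Proof.
move=> hs; split; first by exists M => x k _; exact: lser_coef_gt.
move=> k x Dx; rewrite /= /Defs.lser_coef.
by case: ifP => _; [exact: (holomorphic_is_derive (hs _) Dx)|exact: is_derive_const].
Qed.

Lemma amplitude_exists : exists s : nat -> C -> C,
  [/\ forall x, s 0%N x = 1, forall n, holomorphic D (s n) &
      forall x, lderiv (lser 0 (s^~ x)) = reg_dt x * lser 0 (s^~ x)].
Proof.
(* The sequences are chosen separately at each point, but s_0 = 1 and the recursion determine them,
   so holomorphy in x follows by induction from that of [reg_coef]. *)
have [s sP] := choice (fun x => @conv_ode C (fun n => reg_coef n x) succ_neq0).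
have s0 x : s x 0%N = 1 by case: (sP x).
have sS x n : s x n.+1
    = - (n.+1)%:R^-1 * \sum_(i < n.+1) reg_coef i x * s x (n - i)%N.
  have [_ e] := sP x; rewrite mulNr -mulrN -[- _]e mulKf//; exact: succ_neq0.
exists (fun n x => s x n); split; first exact: s0.
- suff h n : Cn_holomorphic D 1 (s^~ n) by move=> n; exact: Cn_holomorphic1 (h n).
  elim/ltn_ind: n => -[_|n IH].
    by apply: (Cn_holomorphic_eq D_open _ (Cn_holomorphic_cst D_open 1 1)) => x _;
      rewrite s0.
  apply: (Cn_holomorphic_eq D_open (f := fun x => - (n.+1)%:R^-1
    * \sum_(i < n.+1) reg_coef i x * s x (n - i)%N)).
    by move=> x _; rewrite sS.
  apply: (Cn_holomorphicM D_open); first exact: Cn_holomorphic_cst.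
  apply: (Cn_holomorphic_sum D_open) => i _.
  apply: (Cn_holomorphicM D_open); first exact: Cn_holomorphic_reg_coef.
  by apply: IH; rewrite ltnS leq_subr.
- by move=> x; apply: lderiv_lser_conv; case: (sP x).
Qed.

(** Chosen so that P_t = t^2/4 - x/2, the part of Y_t/Y left over by [reg_dt] and t^(-alpha). *)
Definition airy_phase : {poly C -> C} :=
  Poly ([:: fun=> 0; fun x : C => - (x / 2); fun=> 0; fun=> 12^-1] : seq (C -> C)).

Lemma airy_phaseE x : phase airy_phase x = 't * (- (x%:L * 2^-1)) + 't ^+ 3 * 12^-1.
Proof.
(* The size of the polynomial is only bounded by 4 here; zero terms pad the sum. *)
have -> : phase airy_phase x
    = \sum_(i < 4) (airy_phase`_i x)%:L * 't ^+ i.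
  have le4 : (size airy_phase <= 4)%N by exact: size_Poly.
  rewrite /phase -(big_mkord xpredT (fun i => (airy_phase`_i x)%:L * 't ^+ i)).
  rewrite -(big_mkord xpredT (fun i => (airy_phase`_i x)%:L * 't ^+ i)).
  rewrite [RHS](big_cat_nat (leq0n (size airy_phase)) le4) /= [X in _ = _ + X]big1_seq ?addr0//.
  by move=> i; rewrite mem_index_iota => /andP[_ /andP[lei _]];
    rewrite nth_default// lmono0 mul0r.
rewrite !big_ord_recl big_ord0 !coef_Poly /=.
rewrite !lmono0 !mul0r !add0r addr0 expr1.
by rewrite lmonoN lconst_quot !lmonoV !lmono_nat mulrC (mulrC _ ('t ^+ 3)).
Qed.

(** This is the equality of mixed derivatives of log Y_1, where Y_x/Y = psi y - t/2 and Y_t/Y =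
    [reg_dt] + P_t + c/t; the explicit terms contribute -1/2 to both sides. *)
Lemma has_dx_reg_dt : has_dx D reg_dt (fun x => (psi x)%:L * lderiv (y x)).
Proof.
have hc (f : L) := has_dx_cst D f.
have h1 := has_dxD has_dx_dpsi (has_dxN (has_dxM D_open (hc 't) has_dx_psi)).
have h2 := has_dxM D_open (has_dxM D_open h1 has_dx_riccati_sol) (hc 2^-1).
have h3 := has_dxM D_open (has_dxM D_open has_dx_psi has_dx_phi) (hc 2^-1).
have h := has_dxD (has_dxD h2 h3) (hc (lmono alpha (-1))).
apply: (eq_has_dx D_open _ _ h) => x Dx; first by rewrite reg_dtE.
rewrite riccati_dtE// riccati_dxE//.
exact: reg_dx_identity two_neq0.
Qed.

Lemma amplitude_dxE (s : nat -> C -> C) : (forall x, s 0%N x = 1) ->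
  (forall n, holomorphic D (s n)) ->
  (forall x, lderiv (lser 0 (s^~ x)) = reg_dt x * lser 0 (s^~ x)) ->
  forall x, D x -> lser 0 (fun n => derive1 (s n) x)
    = (psi x)%:L * y x * lser 0 (s^~ x).
Proof.
move=> s0 hs dts x Dx.
pose S x : L := lser 0 (s^~ x); pose S' x : L := lser 0 (fun n => derive1 (s n) x).
have hdS : has_dx D S S' := has_dx_lser 0 hs.
rewrite -/(S x) -/(S' x); apply: subr0_eq.
apply: (@linear_dt_eq0 _ _ (reg_dt x) succ_neq0).
- by move=> k; exact: lser_coef_gt.
- have hyS k : -1 < k -> ((psi x)%:L * y x * S x) k = 0.
    apply: (@lcoefM_eq0 _ _ _ (-1) 0); last by move=> j; exact: lser_coef_gt.
    apply: (@lcoefM_eq0 _ _ _ 0 (-1)); last by move=> j; exact: lser_coef_gt.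
    by move=> j j0; rewrite /= gt_eqF.
  (* At t^0 only s_0' could survive, and s_0 is the constant 1. *)
  move=> k k1; rewrite lcoefD lcoefN hyS// subr0.
  have [k0|k0] := ltP 0 k; first exact: lser_coef_gt.
  have -> : k = 0 - 0%:Z by lia.
  rewrite lser_coefE (eq_derive1 D_open (g := fun=> 1) _ Dx) => [|w _]; last exact: s0.
  exact: is_derive_derive1 (is_derive_const _ _).
(* S_xt is obtained by differentiating S_t = [reg_dt] S in x. *)
- have dtS' : lderiv (S' x) = (psi x)%:L * lderiv (y x) * S x + reg_dt x * S' x.
    have e : (fun w => lderiv (S w)) = (fun w => reg_dt w * S w).
      by apply/funext => w; exact: dts.
    have := has_dx_lderiv hdS; rewrite e => hd.
    by rewrite -(has_dxE hd Dx) (has_dxE (has_dxM D_open has_dx_reg_dt hdS) Dx).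
  rewrite lderivD lderivN !lderivM dtS' lderiv_cst [lderiv (S x)]dts.
  exact: deriv_defect_identity.
Qed.

Lemma formal_solution_exists :
  exists (P : {poly C -> C}) (c : C) (Y1 : formal_fun P c),
    is_formal_fun D Y1 /\ log_dx_compatible Y1 /\ log_dt_compatible Y1.
Proof.
have [s [s0 hs dts]] := amplitude_exists.
pose S x : L := lser 0 (s^~ x).
pose S' x : L := lser 0 (fun n => derive1 (s n) x).
have hdS : has_dx D S S' := has_dx_lser 0 hs.
have S00 x : S x 0 = 1 by rewrite /S -(subr0 0) lser_coefE.
have S_neq0 x : S x != 0.
  apply/eqP => /(congr1 (fun f : L => f 0)).
  by rewrite S00; exact/eqP/oner_neq0.
have hdP : has_dx D (phase airy_phase) (fun=> - ('t * 2^-1)).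
  have hc (f : L) := has_dx_cst D f.
  have := has_dxD (has_dxM D_open (hc 't) (has_dxN (has_dxM D_open has_dx_x (hc 2^-1))))
    (hc ('t ^+ 3 * 12^-1)).
  apply: eq_has_dx => // x Dx; first by rewrite airy_phaseE.
  by rewrite mul0r add0r mul1r mulr0 !addr0 mulrN.
have twelve_neq0 : 12 != 0 :> C by rewrite pnatr_eq0.
exists airy_phase, (- alpha), (FormalFun _ _ S).
split; [split|split].
- move=> i; rewrite coef_Poly.
  have hc c : holomorphic D (fun=> c).
    exact: Cn_holomorphic1 (Cn_holomorphic_cst D_open 0 c).
  (* Only the coefficient of t depends on x; indices from 4 on lie past the end of the list. *)
  case: i => [|[|[|[|i]]]] /=; [exact: hc| |exact: hc|exact: hc|].
    apply: (Cn_holomorphic1 (n := 0)); apply: (Cn_holomorphic_eq D_open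
      (f := fun x => x * (- 2^-1))) => [x _|]; first by rewrite mulrN.
    exact: (Cn_holomorphicM D_open (Cn_holomorphic_id D_open 0)
      (Cn_holomorphic_cst D_open 0 (- 2^-1))).
  by rewrite nth_nil; exact: hc.
- exact: has_dx_holomorphic hdS.
- exists 0 => x Dx; split; last by move=> k; exact: lser_coef_gt.
  by rewrite [X in X != 0]S00 oner_neq0.
- move=> x Dx; rewrite series_at_inftyE.
  rewrite /formal_ratio /= (has_dxE hdP Dx) (has_dxE hdS Dx) [S' x]amplitude_dxE//.
  exact: log_dx_solution t_neq0 (psiL_neq0 Dx) (S_neq0 x).
- move=> x Dx; rewrite series_at_inftyE lmono_ode_psi//.
  rewrite /formal_ratio /= /laurent_dt airy_phaseE lderiv_airy// dts reg_dtE//.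
  rewrite -/(S x) (_ : lmono alpha (-1) = alpha%:L / 't) ?lmonoN; last exact: lmono_div_t.
  exact: log_dt_solution two_neq0 t_neq0 (dpsi_tpsi_neq0 Dx) (S_neq0 x).
Qed.

End Riccati.

Theorem theorem2p7 (R : realType) (D : set (Cplx R))
    (phi psi : Cplx R -> Cplx R) (alpha : Cplx R)
    (a b : nat -> Cplx R -> Cplx R)
    (hD : domain D)
    (hphi : holomorphic D phi) (hpsi : holomorphic D psi)
    (hphi' : holomorphic D (derive1 phi)) (hpsi' : holomorphic D (derive1 psi))
    (phi_neq0 : forall x, D x -> phi x != 0)
    (psi_neq0 : forall x, D x -> psi x != 0)
    (ode_psi : forall x, D x ->
      derive1n 2 psi x / psi x = - 2 * psi x * phi x + 2 * x)
    (ode_phi : forall x, D x ->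
      derive1n 2 phi x / phi x = - 2 * psi x * phi x + 2 * x)
    (wronskian : forall x, D x ->
      derive1 phi x * psi x - phi x * derive1 psi x = 2 * alpha)
    (a0 : forall x, D x -> a 0%N x = phi x)
    (b0 : forall x, D x -> b 0%N x = psi x)
    (aS : forall n x, (1 <= n)%N -> D x ->
      a n x = derive1 (a n.-1) x
        + psi x * \sum_(i < n) \sum_(j < n | (i + j + 2 == n)%N) a i x * a j x)
    (bS : forall n x, (1 <= n)%N -> D x ->
      b n x = derive1 (b n.-1) x
        + phi x * \sum_(i < n) \sum_(j < n | (i + j + 2 == n)%N) b i x * b j x) :
  let F := series_at_infty a in
  let G := series_at_infty b in
  let z := fun x => - psi x * phi x in
  let u_m1 := fun x => - derive1 psi x / psi x in
  let u_0 := fun x => derive1 phi x / phi x in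
  let eqs_Y := fun (P : {poly Cplx R -> Cplx R}) (c : Cplx R)
      (Y1 : formal_fun P c) =>
    (forall x, D x ->
      F x = 't / (psi x)%:L
            * (formal_ratio (formal_dx Y1) Y1 x + 't / 2)) /\
    (forall x, D x ->
      F x = 2 * 't / ((derive1 psi x)%:L - 't * (psi x)%:L)
            * (formal_ratio (formal_dt Y1) Y1 x
               + 4^-1 * ((derive1n 2 psi x / psi x)%:L - 't ^+ 2))) in
  let eqs_Z := fun (P : {poly Cplx R -> Cplx R}) (c : Cplx R)
      (Z1 : formal_fun P c) =>
    (forall x, D x ->
      G x = 't / (phi x)%:L
            * (formal_ratio (formal_dx Z1) Z1 x + 't / 2)) /\
    (forall x, D x ->
      G x = 2 * 't / ((derive1 phi x)%:L - 't * (phi x)%:L)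
            * (formal_ratio (formal_dt Z1) Z1 x
               + 4^-1 * ((derive1n 2 phi x / phi x)%:L - 't ^+ 2))) in
  (* (i) *)
  ((exists (P : {poly Cplx R -> Cplx R}) (c : Cplx R) (Y1 : formal_fun P c),
      is_formal_fun D Y1 /\ eqs_Y P c Y1) /\
   (forall (P : {poly Cplx R -> Cplx R}) (c : Cplx R) (Y1 : formal_fun P c),
      is_formal_fun D Y1 -> eqs_Y P c Y1 ->
      let Y2 := formal_scale (fun x => (psi x)%:L^-1)
        (formal_add (formal_dx Y1) (formal_scale (fun=> 't / 2) Y1)) in
      forall x, D x ->
        col2 (formal_dt Y1) (formal_dt Y2) x
        = mat2 ('t ^+ 2 / 4 - (z x)%:L / 2 - x%:L / 2)
               (- ((psi x)%:L / 2) * ('t + (u_m1 x)%:L))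
               ((psi x)%:L^-1
                * (((u_m1 x)%:L - 't) * ((z x)%:L / 2) + alpha%:L))
               (- ('t ^+ 2 / 4) + (z x)%:L / 2 + x%:L / 2)
          *m col2 Y1 Y2 x
        /\
        col2 (formal_dx Y1) (formal_dx Y2) x
        = mat2 (- ('t / 2)) (psi x)%:L
               (z x / psi x)%:L ('t / 2)
          *m col2 Y1 Y2 x)) /\
  (* (ii) *)
  ((exists (P : {poly Cplx R -> Cplx R}) (c : Cplx R) (Z1 : formal_fun P c),
      is_formal_fun D Z1 /\ eqs_Z P c Z1) /\
   (forall (P : {poly Cplx R -> Cplx R}) (c : Cplx R) (Z1 : formal_fun P c),
      is_formal_fun D Z1 -> eqs_Z P c Z1 ->
      let Z2 := formal_scale (fun x => (phi x)%:L^-1)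
        (formal_add (formal_dx Z1) (formal_scale (fun=> 't / 2) Z1)) in
      forall x, D x ->
        col2 (formal_dt Z1) (formal_dt Z2) x
        = mat2 ('t ^+ 2 / 4 - (z x)%:L / 2 - x%:L / 2)
               (- ((phi x)%:L / 2) * ('t - (u_0 x)%:L))
               (- (phi x)%:L^-1
                * (((u_0 x)%:L + 't) * ((z x)%:L / 2) + alpha%:L))
               (- ('t ^+ 2 / 4) + (z x)%:L / 2 + x%:L / 2)
          *m col2 Z1 Z2 x
        /\
        col2 (formal_dx Z1) (formal_dx Z2) x
        = mat2 (- ('t / 2)) (phi x)%:L
               (z x / phi x)%:L ('t / 2)
          *m col2 Z1 Z2 x)).
Proof.
move=> F G z u_m1 u_0 eqs_Y eqs_Z.
have D_open : open D by case: hD.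
(* The exchange of phi and psi permutes factors in the potential and negates the Wronskian, hence
   alpha. *)
have ode_psi_sw x : D x -> derive1n 2 psi x / psi x = - 2 * phi x * psi x + 2 * x.
  by move=> Dx; rewrite ode_psi// mulrAC.
have ode_phi_sw x : D x -> derive1n 2 phi x / phi x = - 2 * phi x * psi x + 2 * x.
  by move=> Dx; rewrite ode_phi// mulrAC.
have wronskian_sw x : D x ->
    derive1 psi x * phi x - psi x * derive1 phi x = 2 * - alpha.
  by move=> Dx; exact: wronskian_swap (wronskian x Dx).
split; split.
- have [P [c [Y1 [hY [cdx cdt]]]]] := formal_solution_exists D_open
    hphi hpsi hphi' hpsi' phi_neq0 psi_neq0 ode_psi ode_phi wronskian a0 aS.
  by exists P, c, Y1; split; [exact: hY|split; [exact: cdx|exact: cdt]].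
- move=> P c Y1 hY [cdx cdt].
  apply: (formal_system D_open hphi hpsi hphi' hpsi' phi_neq0 psi_neq0
    ode_psi ode_phi wronskian a0 aS (z := z) (u := u_m1) _ _ hY cdx cdt);
    by move=> x _.
- have [P [c [Z1 [hZ [cdx cdt]]]]] := formal_solution_exists D_open
    hpsi hphi hpsi' hphi' psi_neq0 phi_neq0 ode_phi_sw ode_psi_sw wronskian_sw b0 bS.
  by exists P, c, Z1; split; [exact: hZ|split; [exact: cdx|exact: cdt]].
- move=> P c Z1 hZ [cdx cdt] Z2 x Dx.
  have zE w : D w -> z w = - phi w * psi w.
    by move=> _; rewrite /z mulNr mulrC -mulNr.
  (* The entry t + u_(-1) turns into t - u_0, so [- u_0] is supplied for [u]. *)
  have uE w : D w -> - u_0 w = - derive1 phi w / phi w.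
    by move=> _; rewrite mulNr.
  have [dtZ dxZ] := formal_system D_open hpsi hphi hpsi' hphi' psi_neq0 phi_neq0
    ode_phi_sw ode_psi_sw wronskian_sw b0 bS zE uE hZ cdx cdt Dx.
  (* The signs of - u_0 and - alpha are pulled out of the lower-left entry. *)
  by split; [rewrite dtZ !lmonoN lower_left_opp|exact: dxZ].
Qed.
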